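(* Let $X$ be a paracompact finite $C$-space, $(Y,\rho)$ a metric space, and $\varphi:X\rightrightarrows Y$ a $\rho$-continuous mapping such that each $\varphi(x)$, $x\in X$, is uniformly $UV^\omega$. Then for every continuous function $\varepsilon:X\to(0,+\infty)$, $\varphi$ has a continuous $\varepsilon$-selection.
   Context: A normal space $X$ is a finite $C$-space if for every sequence $\{\mathscr{U}_n:n<\omega\}$ of finite open covers of $X$ there is a finite sequence $\{\mathscr{V}_n:n\le k\}$ of families of pairwise disjoint open subsets of $X$ such that each $\mathscr{V}_n$ refines $\mathscr{U}_n$ and $\bigcup_{n\le k}\mathscr{V}_n$ covers $X$. A set-valued mapping $\varphi:X\rightrightarrows Y$ assigns a nonempty subset $\varphi(x)\subset Y$ to each $x$. $\mathbf{O}_\varepsilon(S)=\bigcup_{q\in S}\{y:\rho(y,q)<\varepsilon\}$. $\varphi$ is $\rho$-continuous if for every $\varepsilon>0$ each $x\in X$ has a neighbourhood $V$ with $\varphi(x)\subset\mathbf{O}_\varepsilon(\varphi(p))$ and $\varphi(p)\subset\mathbf{O}_\varepsilon(\varphi(x))$ for all $p\in V$. For $S\subset T$, $S\hookrightarrow_\omega T$ means that for every finite-dimensional simplicial complex $\Sigma$ (all simplices of cardinality at most some fixed $k+1$; geometric realisation $|\Sigma|$ with the Whitehead topology), every continuous map $g:|\Sigma|\to S$ is null-homotopic in $T$. A subset $S\subset Y$ is uniformly $UV^\omega$ if for each $\varepsilon>0$ there is $\delta\in(0,\varepsilon]$ with $\mathbf{O}_\delta(S)\hookrightarrow_\omega\mathbf{O}_\varepsilon(S)$.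 A map $f:X\to Y$ is an $\varepsilon$-selection for $\varphi$ if $f(x)\in\mathbf{O}_{\varepsilon(x)}(\varphi(x))$ for every $x\in X$. *)

(* Defs.v *)
From Stdlib Require Import Reals List.
Open Scope R_scope.

Definition is_topology {X : Type} (op : (X -> Prop) -> Prop) : Prop :=
  op (fun _ => True) /\
  (forall A B, op A -> op B -> op (fun x => A x /\ B x)) /\
  (forall (I : Type) (F : I -> X -> Prop),
      (forall i, op (F i)) -> op (fun x => exists i, F i x)).

Definition is_closed {X : Type} (op : (X -> Prop) -> Prop) (C : X -> Prop) :=
  op (fun x => ~ C x).

Definition hausdorff {X : Type} (op : (X -> Prop) -> Prop) : Prop :=
  forall x y : X, x <> y ->
    exists U V, op U /\ op V /\ U x /\ V y /\ (forall z, ~ (U z /\ V z)).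

Definition normal_space {X : Type} (op : (X -> Prop) -> Prop) : Prop :=
  (forall x : X, is_closed op (fun y => y = x)) /\
  (forall A B : X -> Prop, is_closed op A -> is_closed op B ->
     (forall z, ~ (A z /\ B z)) ->
     exists U V, op U /\ op V /\ (forall z, A z -> U z) /\ (forall z, B z -> V z)
       /\ (forall z, ~ (U z /\ V z))).

Definition paracompact {X : Type} (op : (X -> Prop) -> Prop) : Prop :=
  hausdorff op /\
  forall (I : Type) (U : I -> X -> Prop),
    (forall i, op (U i)) -> (forall x, exists i, U i x) ->
    exists (J : Type) (W : J -> X -> Prop),
      (forall j, op (W j)) /\ (forall x, exists j, W j x) /\
      (forall j, exists i, forall x, W j x -> U i x) /\
      (forall x, exists N, op N /\ N x /\
         exists l : list J, forall j, (exists y, N y /\ W j y) -> In j l).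

Definition finite_C_space {X : Type} (op : (X -> Prop) -> Prop) : Prop :=
  normal_space op /\
  forall U : nat -> list (X -> Prop),
    (forall n A, In A (U n) -> op A) ->
    (forall n x, exists A, In A (U n) /\ A x) ->
    exists (k : nat) (J : nat -> Type) (V : forall n, J n -> X -> Prop),
      (forall n (j : J n), (n <= k)%nat -> op (V n j)) /\
      (forall n (i j : J n), (n <= k)%nat -> i <> j -> forall x, ~ (V n i x /\ V n j x)) /\
      (forall n (j : J n), (n <= k)%nat ->
         exists A, In A (U n) /\ forall x, V n j x -> A x) /\
      (forall x, exists n (j : J n), (n <= k)%nat /\ V n j x).

Definition is_metric {Y : Type} (rho : Y -> Y -> R) : Prop :=
  (forall x y, 0 <= rho x y) /\
  (forall x y, rho x y = 0 <-> x = y) /\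
  (forall x y, rho x y = rho y x) /\
  (forall x y z, rho x z <= rho x y + rho y z).

Definition metric_open {Y : Type} (rho : Y -> Y -> R) (W : Y -> Prop) : Prop :=
  forall y, W y -> exists r, 0 < r /\ forall z, rho y z < r -> W z.

Definition continuous_into {X Y : Type} (op : (X -> Prop) -> Prop)
  (rho : Y -> Y -> R) (f : X -> Y) : Prop :=
  forall W, metric_open rho W -> op (fun x => W (f x)).

Definition Onbhd {Y : Type} (rho : Y -> Y -> R) (eps : R) (S : Y -> Prop) : Y -> Prop :=
  fun y => exists q, S q /\ rho y q < eps.

Definition subset {Y : Type} (A B : Y -> Prop) : Prop := forall y, A y -> B y.

Definition rho_continuous {X Y : Type} (op : (X -> Prop) -> Prop)
  (rho : Y -> Y -> R) (phi : X -> Y -> Prop) : Prop :=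
  forall eps, 0 < eps -> forall x, exists V, op V /\ V x /\
    forall p, V p -> subset (phi x) (Onbhd rho eps (phi p)) /\
                     subset (phi p) (Onbhd rho eps (phi x)).

Definition finite_set {V : Type} (s : V -> Prop) : Prop :=
  exists l : list V, forall v, s v -> In v l.

Definition fd_simplicial_complex {V : Type} (simp : (V -> Prop) -> Prop) : Prop :=
  (forall s, simp s -> finite_set s /\ exists v, s v) /\
  (forall s t, simp s -> (forall v, t v -> s v) -> (exists v, t v) -> simp t) /\
  (exists k : nat, forall s, simp s ->
     exists l : list V, (length l <= S k)%nat /\ forall v, s v -> In v l).

Definition support {V : Type} (a : V -> R) : V -> Prop := fun v => a v <> 0.

(* points of the geometric realisation |Sigma| (barycentric coordinates) *)
Definition in_realization {V : Type} (simp : (V -> Prop) -> Prop) (a : V -> R) : Prop :=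
  (forall v, 0 <= a v) /\ simp (support a) /\
  exists l : list V, NoDup l /\ (forall v, In v l <-> a v <> 0) /\
    fold_right (fun v acc => a v + acc) 0 l = 1.

Definition realization {V : Type} (simp : (V -> Prop) -> Prop) : Type :=
  { a : V -> R | in_realization simp a }.

(* Whitehead (weak) topology: U is open iff U meets each closed simplex |sigma|
   in a set open in |sigma| (Euclidean topology of |sigma|) *)
Definition whitehead_open {V : Type} (simp : (V -> Prop) -> Prop)
  (U : realization simp -> Prop) : Prop :=
  forall sigma, simp sigma ->
  forall a : realization simp, U a -> subset (support (proj1_sig a)) sigma ->
    exists r, 0 < r /\ forall b : realization simp,
      subset (support (proj1_sig b)) sigma ->
      (forall v, sigma v -> Rabs (proj1_sig a v - proj1_sig b v) < r) -> U b.

Definition continuous_homotopy {V Y : Type} (simp : (V -> Prop) -> Prop)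
  (rho : Y -> Y -> R) (H : realization simp -> R -> Y) : Prop :=
  forall W, metric_open rho W ->
  forall a t, 0 <= t <= 1 -> W (H a t) ->
    exists U r, whitehead_open simp U /\ U a /\ 0 < r /\
      forall b s, U b -> 0 <= s <= 1 -> Rabs (s - t) < r -> W (H b s).

Definition hook_omega {Y : Type} (rho : Y -> Y -> R) (S T : Y -> Prop) : Prop :=
  forall (V : Type) (simp : (V -> Prop) -> Prop),
    fd_simplicial_complex simp ->
    forall g : realization simp -> Y,
      continuous_into (whitehead_open simp) rho g ->
      (forall a, S (g a)) ->
      exists H : realization simp -> R -> Y,
        continuous_homotopy simp rho H /\
        (forall a t, 0 <= t <= 1 -> T (H a t)) /\
        (forall a, H a 0 = g a) /\
        exists c, T c /\ forall a, H a 1 = c.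

Definition uniformly_UV_omega {Y : Type} (rho : Y -> Y -> R) (S : Y -> Prop) : Prop :=
  forall eps, 0 < eps -> exists delta, 0 < delta <= eps /\
    hook_omega rho (Onbhd rho delta S) (Onbhd rho eps S).

Definition Rmetric (x y : R) : R := Rabs (x - y).

(* Main.v *)
Require Import Defs.
From Stdlib Require Import Reals List Lra Lia Arith ZArith Classical ClassicalEpsilon
  FunctionalExtensionality PropExtensionality.
Open Scope R_scope.

(* Dimension theory reduces arbitrary open covers to the finite ones of the definition: if finitely
   many disjoint families never sufficed, the bad slabs of an exhaustion could be merged into one
   sequence of two-element covers violating the finite C-property.  Hence all but a bounded part of
   the exhaustion has finite dimension, and any sequence of open covers of X admits finitely many
   disjoint refining families that together cover X.
   Apply this to covers on which the hypothesis on phi gives Phi_{n+1}(x) < S < T < Phi_n(x), with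
   S null-homotopic in T and Phi_0(x) the eps(x)-neighbourhood of phi(x).  A map of the nerve is
   built from the last family down to the first: a vertex of level n is joined by a cone, over the
   null-homotopy of the map on its link.  Composing with a barycentric map gives the selection. *)

(** The obstacle is that the finite C-property says nothing about infinite covers. Two-element
    covers given on the members of a disjoint, locally finite family of closed sets glue to
    two-element covers of X, whereas finite covers of growing size would glue to infinite ones. This
    is why dimension is expressed by two-element covers, and how one number comes to bound the
    dimension of all far slabs; the bound is then turned back into statements on finite, countable
    and arbitrary covers. Having finitely many families matters twice. A simplex of the nerve has at
    most one vertex per family, so the nerve is finite-dimensional, and [hook_omega] speaks of no
    other complexes. Moreover the vertices of one level are never joined, so their cones do not
    interfere, and the link of a vertex of level n lies in the later levels, where the values over x
    are already in Phi_{n+1}(x). The covers have to be fixed before the number of families is known.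
    Hence infinitely many contractions are prepared, and the descent starts only afterwards. *)

(** * Open and closed sets, locally finite families, normality *)

Section Topology.
Context {X : Type} {op : (X -> Prop) -> Prop}.
Hypothesis top : is_topology op.
Notation closed := (is_closed op).

Lemma open_ext (A B : X -> Prop) : op A -> (forall x, A x <-> B x) -> op B.
Proof.
  intros HA H. replace B with A; auto.
  extensionality x. apply propositional_extensionality, H.
Qed.

Lemma closed_ext (A B : X -> Prop) : closed A -> (forall x, A x <-> B x) -> closed B.
Proof. intros HA H. eapply open_ext; [exact HA|]. intros x. specialize (H x). simpl. tauto. Qed.

(** [A] is the union of all its open subsets; indexing by these subsets instead of by points avoids
    choosing neighbourhoods. *)
Lemma open_local (A : X -> Prop) :
  (forall x, A x -> exists N, op N /\ N x /\ forall y, N y -> A y) -> op A.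
Proof.
  intros H. destruct top as (_ & _ & HU).
  apply (open_ext (fun x => exists N : {N | op N /\ forall y, N y -> A y}, proj1_sig N x)).
  - apply HU. intros [N [HN ?]]; exact HN.
  - intros x. split.
    + intros [[N [? HN]] Hx]. apply HN, Hx.
    + intros Hx. destruct (H x Hx) as (N & HN & HNx & Hs).
      exists (exist _ N (conj HN Hs)). exact HNx.
Qed.

Lemma open_true : op (fun _ => True).
Proof. apply top. Qed.

Lemma open_and (A B : X -> Prop) : op A -> op B -> op (fun x => A x /\ B x).
Proof. apply top. Qed.

Lemma open_exists {I : Type} (F : I -> X -> Prop) :
  (forall i, op (F i)) -> op (fun x => exists i, F i x).
Proof. apply top. Qed.

Lemma open_const (P : Prop) : op (fun _ => P).
Proof. apply open_local. intros x Hx. exists (fun _ => True). split; [apply open_true | auto]. Qed.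

Lemma open_or (A B : X -> Prop) : op A -> op B -> op (fun x => A x \/ B x).
Proof.
  intros HA HB. apply open_local. intros x [H|H]; [exists A | exists B]; auto.
Qed.

Lemma open_forall_list {I : Type} (l : list I) (F : I -> X -> Prop) :
  (forall i, In i l -> op (F i)) -> op (fun x => forall i, In i l -> F i x).
Proof.
  induction l as [|i l IH]; intros H.
  - eapply open_ext; [apply open_true|]. simpl; tauto.
  - apply (open_ext (fun x => F i x /\ forall j, In j l -> F j x)).
    + apply open_and; [apply H; left; auto|]. apply IH. intros j Hj; apply H; right; auto.
    + intros x; simpl; split.
      * intros [H1 H2] j [<-|Hj]; auto.
      * intros H1; split; auto.
Qed.

Lemma open_forall_lt (n : nat) (F : nat -> X -> Prop) :
  (forall i, (i < n)%nat -> op (F i)) -> op (fun x => forall i, (i < n)%nat -> F i x).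
Proof.
  intros H. eapply open_ext; [apply (open_forall_list (seq 0 n) F)|].
  - intros i Hi. apply in_seq in Hi. apply H. lia.
  - intros x; split; intros H1 i Hi; apply H1; try apply in_seq; try apply in_seq in Hi; lia.
Qed.

Lemma open_not_closed (A : X -> Prop) : closed A -> op (fun x => ~ A x).
Proof. auto. Qed.

Lemma closed_not_open (A : X -> Prop) : op A -> closed (fun x => ~ A x).
Proof. intros H. eapply open_ext; [exact H|]. intros x; simpl. tauto. Qed.

Lemma closed_const (P : Prop) : closed (fun _ => P).
Proof. exact (open_const (~ P)). Qed.

Lemma closed_and (A B : X -> Prop) : closed A -> closed B -> closed (fun x => A x /\ B x).
Proof.
  intros HA HB. eapply open_ext; [apply (open_or _ _ HA HB)|]. intros x; simpl; tauto.
Qed.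

Lemma closed_or (A B : X -> Prop) : closed A -> closed B -> closed (fun x => A x \/ B x).
Proof.
  intros HA HB. eapply open_ext; [apply (open_and _ _ HA HB)|]. intros x; simpl; tauto.
Qed.

Lemma closed_minus (A B : X -> Prop) : closed A -> op B -> closed (fun x => A x /\ ~ B x).
Proof. intros HA HB. apply closed_and; auto. apply closed_not_open; auto. Qed.

Lemma closed_forall {I : Type} (F : I -> X -> Prop) :
  (forall i, closed (F i)) -> closed (fun x => forall i, F i x).
Proof.
  intros H. eapply open_ext; [apply (open_exists (fun i x => ~ F i x)); apply H|].
  intros x; split.
  - intros [i Hi] H1; auto.
  - apply not_all_ex_not.
Qed.

Lemma closed_imp (P : Prop) (A : X -> Prop) : closed A -> closed (fun x => P -> A x).
Proof.
  intros H. destruct (classic P).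
  - eapply closed_ext; [exact H|]. tauto.
  - eapply closed_ext; [apply (closed_const True)|]. tauto.
Qed.

Lemma open_imp (P : Prop) (A : X -> Prop) : op A -> op (fun x => P -> A x).
Proof.
  intros H. destruct (classic P).
  - eapply open_ext; [exact H|]. tauto.
  - eapply open_ext; [apply open_true|]. tauto.
Qed.

Lemma closed_exists_lt (n : nat) (F : nat -> X -> Prop) :
  (forall i, (i < n)%nat -> closed (F i)) -> closed (fun x => exists i, (i < n)%nat /\ F i x).
Proof.
  intros H. eapply open_ext; [apply (open_forall_lt n (fun i x => ~ F i x) H)|].
  intros x; split.
  - intros H1 [i [Hi Hx]]. apply (H1 i Hi Hx).
  - intros H1 i Hi Hx. apply H1. eauto.
Qed.

Definition locally_finite {I : Type} (F : I -> X -> Prop) : Prop :=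
  forall x, exists N, op N /\ N x /\
    exists l : list I, forall i, (exists y, N y /\ F i y) -> In i l.

Lemma locally_finite_sub {I : Type} (F G : I -> X -> Prop) :
  locally_finite F -> (forall i x, G i x -> F i x) -> locally_finite G.
Proof.
  intros H HG x. destruct (H x) as (N & HN & Hx & l & Hl).
  exists N. repeat split; auto. exists l. intros i (y & Hy & Hi). apply Hl. eauto.
Qed.

Lemma closed_lf_union {I : Type} (F : I -> X -> Prop) :
  locally_finite F -> (forall i, closed (F i)) -> closed (fun x => exists i, F i x).
Proof.
  intros Hlf Hc. apply open_local. intros x Hx.
  destruct (Hlf x) as (N & HN & HNx & l & Hl).
  exists (fun y => N y /\ forall i, In i l -> ~ F i y). split; [|split].
  - apply open_and; auto. apply open_forall_list. intros; apply Hc.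
  - split; auto. intros i _ Hi. apply Hx. eauto.
  - intros y [Hy H1] [i Hi]. apply (H1 i); auto. apply Hl. eauto.
Qed.

Hypothesis norm : normal_space op.

(** [K] stands in for the closure of [V]: it is the complement of the open set that normality puts
    around the complement of [U]. *)
Lemma interpolate (C U : X -> Prop) : closed C -> op U -> (forall x, C x -> U x) ->
  exists V K, op V /\ closed K /\ (forall x, C x -> V x) /\ (forall x, V x -> K x) /\
    (forall x, K x -> U x).
Proof.
  intros HC HU H. destruct norm as [_ Hn].
  destruct (Hn C (fun x => ~ U x) HC) as (V & W & HV & HW & H1 & H2 & H3).
  - apply closed_not_open; auto.
  - intros z [? ?]; auto.
  - exists V, (fun x => ~ W x). repeat split; auto.
    + apply closed_not_open; auto.
    + intros x ? ?. apply (H3 x); auto.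
    + intros x Hx. apply NNPP. intros Hn'. apply Hx, H2, Hn'.
Qed.

(** Induction with a varying closed set: the part of [E] outside the last [U n] is surrounded by [V]
    inside [K], the earlier sets are shrunk over [K], and [E] minus [V] is left for the index
    [n]. *)
Lemma shrink_finite (n : nat) : forall (U : nat -> X -> Prop) (E : X -> Prop),
  closed E -> (forall i, (i < n)%nat -> op (U i)) ->
  (forall x, E x -> exists i, (i < n)%nat /\ U i x) ->
  exists K : nat -> X -> Prop, (forall i, closed (K i)) /\
    (forall i x, (i < n)%nat -> K i x -> U i x) /\
    (forall x, E x -> exists i, (i < n)%nat /\ K i x).
Proof.
  induction n as [|n IH]; intros U E HE HU Hcov.
  - exists (fun _ _ => False). split; [intros; apply closed_const|]. split; [lia|].
    intros x Hx. destruct (Hcov x Hx) as (i & Hi & _). lia.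
  - destruct (interpolate (fun x => E x /\ ~ U n x) (fun x => exists i, (i < n)%nat /\ U i x))
      as (V & K & HV & HK & H1 & H2 & H3).
    + apply closed_minus; auto.
    + apply open_local. intros x (i & Hi & Hx). exists (U i). split; [apply HU; lia|]. eauto.
    + intros x [Hx Hn]. destruct (Hcov x Hx) as (i & Hi & Hix).
      exists i. split; auto. assert (i <> n) by (intros ->; auto). lia.
    + destruct (IH U K HK) as (L & HL & HL1 & HL2).
      * intros i Hi. apply HU. lia.
      * auto.
      * exists (fun i x => if Nat.eq_dec i n then E x /\ ~ V x else L i x). split; [|split].
        -- intros i. destruct (Nat.eq_dec i n); auto. apply closed_minus; auto.
        -- intros i x Hi. destruct (Nat.eq_dec i n) as [->|Hne].
           ++ intros [Hx HVx]. apply NNPP. intros Hn. apply HVx, H1. auto.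
           ++ apply HL1. lia.
        -- intros x Hx. destruct (classic (V x)) as [HVx|HVx].
           ++ destruct (HL2 x (H2 x HVx)) as (i & Hi & Hix).
              exists i. split; [lia|]. destruct (Nat.eq_dec i n); [lia|auto].
           ++ exists n. split; [lia|]. destruct (Nat.eq_dec n n); [auto|lia].
Qed.

(** Local finiteness makes the union of the other [K j] closed, so [K i] has an open neighbourhood
    whose closed hull misses them. Disjointness then comes from the order of the indices: the hulls
    of smaller index, finitely many closed sets, are removed. *)
Lemma expand_discrete (K U : nat -> X -> Prop) :
  (forall i, closed (K i)) -> locally_finite K -> (forall i, op (U i)) ->
  (forall i x, K i x -> U i x) ->
  (forall i j x, i <> j -> K i x -> K j x -> False) ->
  exists V : nat -> X -> Prop, (forall i, op (V i)) /\ (forall i x, K i x -> V i x) /\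
    (forall i x, V i x -> U i x) /\ (forall i j x, i <> j -> V i x -> V j x -> False).
Proof.
  intros HK Hlf HU HKU Hdis.
  assert (H : forall i, exists p : (X -> Prop) * (X -> Prop), op (fst p) /\ closed (snd p) /\
     (forall x, K i x -> fst p x) /\ (forall x, fst p x -> snd p x) /\
     (forall x, snd p x -> ~ exists j, i <> j /\ K j x)).
  { intros i. destruct (interpolate (K i) (fun x => ~ exists j, i <> j /\ K j x))
      as (V & L & H); auto.
    - apply open_not_closed, closed_lf_union.
      + apply (locally_finite_sub K); auto. tauto.
      + intros j. apply closed_and; auto. apply closed_const.
    - intros x Hx (j & Hij & Hj). eapply Hdis; eauto.
    - exists (V, L); exact H. }
  apply choice in H. destruct H as [p Hp].
  exists (fun i x => (fst (p i) x /\ U i x) /\ forall j, (j < i)%nat -> ~ snd (p j) x).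
  split; [|split; [|split]].
  - intros i. apply open_and; [apply open_and; [apply Hp|auto]|].
    apply open_forall_lt. intros j _. apply (proj1 (proj2 (Hp j))).
  - intros i x Hx. split; [split; [apply Hp|]; auto|].
    intros j Hj Hs. destruct (Hp j) as (_ & _ & _ & _ & H5). apply (H5 x Hs). exists i.
    split; [lia|auto].
  - tauto.
  - assert (Hlt : forall i j x, (i < j)%nat ->
      (fst (p i) x /\ U i x) /\ (forall j, (j < i)%nat -> ~ snd (p j) x) ->
      (fst (p j) x /\ U j x) /\ (forall k, (k < j)%nat -> ~ snd (p k) x) -> False).
    { intros i j x Hij [[H1 _] _] [_ H2]. apply (H2 i Hij). apply Hp, H1. }
    intros i j x Hij Hi Hj. destruct (Nat.lt_total i j) as [h|[h|h]]; [eauto|lia|eauto].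
Qed.

End Topology.

(** * Urysohn functions, and functions subordinate to an open cover *)

Lemma dyadic_between (a b : R) : 0 <= a -> a < b ->
  exists n k : nat, a < INR k / 2 ^ n < b.
Proof.
  intros Ha Hab.
  destruct (INR_unbounded (/ (b - a))) as [n Hn].
  assert (Hp : / (b - a) < 2 ^ n).
  { eapply Rlt_trans; [exact Hn|]. replace 2 with (1 + 1) by ring.
    clear. induction n as [|n IH]; [simpl; lra|].
    rewrite S_INR. simpl. assert (1 <= (1 + 1) ^ n) by (apply pow_R1_Rle; lra). lra. }
  assert (Hpos : 0 < 2 ^ n) by (apply pow_lt; lra).
  assert (H1 : 1 < (b - a) * 2 ^ n).
  { apply (Rmult_lt_compat_l (b - a)) in Hp; [|lra]. rewrite Rinv_r in Hp; lra. }
  assert (Ha2 : 0 <= a * 2 ^ n) by (apply Rmult_le_pos; lra).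
  destruct (archimed (a * 2 ^ n)) as [Hu1 Hu2].
  (* [up] exceeds [a * 2 ^ n] by at most 1, while the stretched interval is longer than 1. *)
  exists n, (Z.to_nat (up (a * 2 ^ n))).
  rewrite INR_IZR_INZ, Z2Nat.id by (apply le_IZR; simpl; lra).
  split; apply (Rmult_lt_reg_r (2 ^ n)); auto; unfold Rdiv;
    rewrite Rmult_assoc, Rinv_l, Rmult_1_r by lra; lra.
Qed.

Section Urysohn.
Context {X : Type} {op : (X -> Prop) -> Prop}.
Hypothesis top : is_topology op.
Hypothesis norm : normal_space op.
Notation closed := (is_closed op).

Definition real_continuous (f : X -> R) : Prop :=
  forall c, op (fun x => c < f x) /\ op (fun x => f x < c).

Lemma closed_ge (f : X -> R) (c : R) : real_continuous f -> closed (fun x => c <= f x).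
Proof.
  intros H. unfold is_closed. apply (open_ext (fun x => f x < c)); [apply H|]. intros x; simpl. lra.
Qed.

Let chain (P : nat -> (X -> Prop) * (X -> Prop)) : Prop :=
  forall k, op (fst (P k)) /\ closed (snd (P k)) /\
    (forall x, fst (P k) x -> snd (P k) x) /\ (forall x, snd (P k) x -> fst (P (S k)) x).

(** One dyadic subdivision: the old terms move to the even places and interpolated pairs fill the
    odd ones. *)
Lemma refine_chain P : chain P -> exists Q, chain Q /\ forall k, Q (2 * k)%nat = P k.
Proof.
  intros HP.
  assert (H : forall k, exists p : (X -> Prop) * (X -> Prop), op (fst p) /\ closed (snd p) /\
    (forall x, snd (P k) x -> fst p x) /\ (forall x, fst p x -> snd p x) /\
    (forall x, snd p x -> fst (P (S k)) x)).
  { intros k. destruct (HP k) as (_ & H2 & _ & H4). destruct (HP (S k)) as (H5 & _).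
    destruct (interpolate norm _ _ H2 H5 H4) as (V & K & H). exists (V, K). exact H. }
  apply choice in H. destruct H as [q Hq].
  exists (fun k => if Nat.even k then P (Nat.div2 k) else q (Nat.div2 k)).
  assert (E : forall k, Nat.even (2 * k) = true) by (intros k; apply Nat.even_spec; exists k; auto).
  split.
  - intros k. destruct (Nat.Even_or_Odd k) as [[m ->]|[m ->]].
    + assert (E2 : Nat.even (S (2 * m)) = false) by (rewrite Nat.even_succ, <- Nat.negb_even, E; auto).
      rewrite E, E2, Nat.div2_double, Nat.div2_succ_double.
      destruct (HP m) as (a & b & c & d). repeat split; auto. apply Hq.
    + assert (E2 : Nat.even (2 * m + 1) = false)
        by (replace (2 * m + 1)%nat with (S (2 * m)) by lia; rewrite Nat.even_succ, <- Nat.negb_even, E; auto).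
      assert (E3 : Nat.even (S (2 * m + 1)) = true)
        by (replace (S (2 * m + 1)) with (2 * (S m))%nat by lia; apply E).
      rewrite E2, E3. replace (S (2 * m + 1)) with (2 * (S m))%nat by lia.
      replace (2 * m + 1)%nat with (S (2 * m)) by lia.
      rewrite Nat.div2_double, Nat.div2_succ_double.
      destruct (Hq m) as (a & b & c & d & e). repeat split; auto.
  - intros k. rewrite E, Nat.div2_double. reflexivity.
Qed.

(** [Q n k] belongs to the level k / 2^n, and [g x] is the supremum of the levels up to 1 whose open
    set misses [x]. The closed components between the levels make the sets [c < g x] open. *)
Lemma urysohn (A U : X -> Prop) : closed A -> op U -> (forall x, A x -> U x) ->
  exists f : X -> R, real_continuous f /\ (forall x, 0 <= f x <= 1) /\
    (forall x, A x -> f x = 1) /\ (forall x, 0 < f x -> U x).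
Proof.
  intros HA HU HAU.
  destruct (interpolate norm A U HA HU HAU) as (V0 & K0 & HV0 & HK0 & h1 & h2 & h3).
  (* Level 0 surrounds [A], level 1 is [U], and all higher levels are the whole space; this forces
     [g] to be 0 on [A] and 1 outside [U]. *)
  set (P0 := fun k : nat => match k with
     | O => (V0, K0) | S O => (U, fun _ : X => True) | _ => (fun _ : X => True, fun _ : X => True) end).
  assert (HP0 : chain P0).
  { intros [|[|k]]; simpl; repeat split; auto;
    try apply (closed_const top True); apply (open_const top True). }
  set (next := fun P : {P | chain P} =>
    let s := constructive_indefinite_description _ (refine_chain (proj1_sig P) (proj2_sig P)) in
    exist chain (proj1_sig s) (proj1 (proj2_sig s))).
  set (Q := fun n => proj1_sig (nat_rect (fun _ => {P | chain P}) (exist chain P0 HP0) (fun _ => next) n)).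
  assert (HQc : forall n, chain (Q n)) by (intros n; unfold Q; apply proj2_sig).
  assert (HQ2 : forall n k, Q (S n) (2 * k)%nat = Q n k).
  { intros n k. unfold Q at 1. cbn [nat_rect]. unfold next at 1.
    match goal with |- context [constructive_indefinite_description ?a ?b] =>
      destruct (constructive_indefinite_description a b) as [q [q1 q2]] end. apply q2. }
  assert (HQ0 : forall k, Q 0%nat k = P0 k) by reflexivity.
  clearbody Q. clear next.
  assert (HQm : forall m n k, Q (m + n)%nat (2 ^ m * k)%nat = Q n k).
  { induction m as [|m IH]; intros n k.
    - simpl. f_equal. lia.
    - replace (2 ^ S m * k)%nat with (2 * (2 ^ m * k))%nat by (simpl; lia).
      change (S m + n)%nat with (S (m + n)). rewrite HQ2. apply IH. }
  assert (Hmono : forall n j k x, (j <= k)%nat -> fst (Q n j) x -> fst (Q n k) x).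
  { intros n j k x Hjk. induction Hjk; auto. intros H. apply (HQc n m). apply (HQc n m). auto. }
  assert (Hp : forall n, 0 < 2 ^ n) by (intros; apply pow_lt; lra).
  assert (INRp : forall n, INR (2 ^ n) = 2 ^ n) by (intros n; rewrite pow_INR; simpl; auto).
  assert (Hcmp : forall n k m j x, INR k / 2 ^ n <= INR j / 2 ^ m -> fst (Q n k) x -> fst (Q m j) x).
  { intros n k m j x Hle Hx. rewrite <- (HQm m n k) in Hx. rewrite <- (HQm n m j).
    replace (n + m)%nat with (m + n)%nat by lia. eapply Hmono; [|exact Hx].
    apply INR_le. rewrite !mult_INR, !INRp.
    apply (Rmult_le_compat_r (2 ^ n * 2 ^ m)) in Hle;
      [|apply Rlt_le, Rmult_lt_0_compat; auto].
    pose proof (Hp n). pose proof (Hp m).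
    replace (INR k / 2 ^ n * (2 ^ n * 2 ^ m)) with (2 ^ m * INR k) in Hle by (field; lra).
    replace (INR j / 2 ^ m * (2 ^ n * 2 ^ m)) with (2 ^ n * INR j) in Hle by (field; lra). auto. }
  set (E := fun x r => r = 0 \/ exists n k, r = INR k / 2 ^ n /\ r <= 1 /\ ~ fst (Q n k) x).
  assert (HE : forall x, exists g, is_lub (E x) g).
  { intros x. destruct (completeness (E x)) as [g Hg].
    - exists 1. intros r [->|(n & k & _ & H & _)]; lra.
    - exists 0. left; auto.
    - exists g; auto. }
  apply choice in HE. destruct HE as [g Hg].
  assert (Hg0 : forall x, 0 <= g x) by (intros x; apply (Hg x); left; auto).
  assert (Hg1 : forall x, g x <= 1).
  { intros x; apply (Hg x). intros r [->|(n & k & _ & H & _)]; lra. }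
  assert (Hlow : forall x n k, INR k / 2 ^ n <= 1 -> ~ fst (Q n k) x -> INR k / 2 ^ n <= g x).
  { intros x n k H1 H2. apply (Hg x). right. exists n, k. auto. }
  assert (Hup : forall x n k, fst (Q n k) x -> g x <= INR k / 2 ^ n).
  { intros x n k Hx. apply (Hg x). intros r [->|(m & j & -> & _ & Hj)].
    - apply Rmult_le_pos; [apply pos_INR|]. apply Rlt_le, Rinv_0_lt_compat; auto.
    - destruct (Rle_dec (INR j / 2 ^ m) (INR k / 2 ^ n)) as [h|h]; auto.
      exfalso. apply Hj. eapply Hcmp; [|exact Hx]. lra. }
  assert (Hgt : forall c, op (fun x => c < g x)).
  { intros c. apply (open_local top). intros x Hx.
    destruct (Rlt_dec c 0) as [Hc|Hc].
    { exists (fun _ => True). split; [apply (open_const top)|]. split; auto.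
      intros y _. specialize (Hg0 y). lra. }
    destruct (dyadic_between ((c + g x) / 2) (g x)) as (n & k & Hk1 & Hk2); [lra|lra|].
    destruct (dyadic_between c ((c + g x) / 2)) as (m & j & Hj1 & Hj2); [lra|lra|].
    (* refine both to a common level, so that the closed set at j sits below the open set at k *)
    assert (Hx1 : ~ fst (Q n k) x) by (intros h; apply Hup in h; lra).
    exists (fun y => ~ snd (Q m j) y). split; [apply HQc|]. split.
    - intros h. apply Hx1.
      rewrite <- (HQm n m j) in h. rewrite <- (HQm m n k).
      replace (n + m)%nat with (m + n)%nat in h by lia.
      apply (HQc (m + n)%nat) in h. eapply Hmono; [|exact h].
      apply INR_lt. rewrite !mult_INR, !INRp.
      assert (h4 : INR j / 2 ^ m < INR k / 2 ^ n) by lra.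
      apply (Rmult_lt_compat_r (2 ^ n * 2 ^ m)) in h4; [|apply Rmult_lt_0_compat; auto].
      pose proof (Hp n). pose proof (Hp m).
      replace (INR k / 2 ^ n * (2 ^ n * 2 ^ m)) with (2 ^ m * INR k) in h4 by (field; lra).
      replace (INR j / 2 ^ m * (2 ^ n * 2 ^ m)) with (2 ^ n * INR j) in h4 by (field; lra). auto.
    - intros y Hy. apply Rlt_le_trans with (INR j / 2 ^ m); auto. apply Hlow.
      + specialize (Hg1 x). lra.
      + intros h. apply Hy. apply (HQc m). auto. }
  assert (Hlt : forall c, op (fun x => g x < c)).
  { intros c. apply (open_local top). intros x Hx.
    destruct (Rlt_dec 1 c) as [Hc|Hc].
    { exists (fun _ => True). split; [apply (open_const top)|]. split; auto.
      intros y _. specialize (Hg1 y). lra. }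
    destruct (dyadic_between (g x) c) as (n & k & Hk1 & Hk2); auto.
    exists (fst (Q n k)). split; [apply HQc|]. split.
    - apply NNPP. intros h. apply Hlow in h; lra.
    - intros y Hy. apply Hup in Hy. lra. }
  exists (fun x => 1 - g x). split; [|split; [|split]].
  - intros c. split.
    + eapply open_ext; [apply (Hlt (1 - c))|]. intros; simpl; lra.
    + eapply open_ext; [apply (Hgt (1 - c))|]. intros; simpl; lra.
  - intros x. specialize (Hg0 x). specialize (Hg1 x). lra.
  - intros x Hx. assert (g x <= INR 0 / 2 ^ 0) by (apply Hup; rewrite HQ0; simpl; auto).
    specialize (Hg0 x). simpl in H. lra.
  - intros x Hx. apply NNPP. intros h.
    assert (INR 1 / 2 ^ 0 <= g x) by (apply Hlow; [simpl; lra|rewrite HQ0; simpl; auto]).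
    simpl in H. lra.
Qed.

Hypothesis para : paracompact op.

Lemma precise_refinement {I : Type} (U : I -> X -> Prop) :
  (forall i, op (U i)) -> (forall x, exists i, U i x) ->
  exists W : I -> X -> Prop, (forall i, op (W i)) /\ (forall i x, W i x -> U i x) /\
    (forall x, exists i, W i x) /\ locally_finite (op := op) W.
Proof.
  intros HU Hcov. destruct para as [_ Hp].
  destruct (Hp I U HU Hcov) as (J & W & HW & HWc & Hr & Hlf).
  apply choice in Hr. destruct Hr as [r Hr].
  exists (fun i x => exists j, r j = i /\ W j x). split; [|split; [|split]].
  - intros i. apply (open_exists top). intros j. apply (open_and top); auto.
    apply (open_const top).
  - intros i x (j & <- & Hj). auto.
  - intros x. destruct (HWc x) as [j Hj]. eauto.
  - intros x. destruct (Hlf x) as (N & HN & Hx & l & Hl). exists N. repeat split; auto.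
    exists (map r l). intros i (y & Hy & j & <- & Hj). apply in_map, Hl. eauto.
Qed.

(** Each point gets an open set with a closed hull inside some [U i]. After a locally finite
    refinement, the closures assigned to one [i] still form a locally finite family, so their union
    is closed. *)
Lemma closed_shrinking {I : Type} (U : I -> X -> Prop) :
  (forall i, op (U i)) -> (forall x, exists i, U i x) ->
  exists F : I -> X -> Prop, (forall i, closed (F i)) /\ (forall i x, F i x -> U i x) /\
    (forall x, exists i, F i x).
Proof.
  intros HU Hcov.
  assert (H : forall x, exists p : I * ((X -> Prop) * (X -> Prop)),
    op (fst (snd p)) /\ closed (snd (snd p)) /\ fst (snd p) x /\
    (forall y, fst (snd p) y -> snd (snd p) y) /\ (forall y, snd (snd p) y -> U (fst p) y)).
  { intros x. destruct (Hcov x) as [i Hi].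
    destruct (interpolate norm (fun y => y = x) (U i)) as (V & K & h1 & h2 & h3 & h4 & h5); auto.
    - apply norm.
    - intros y ->; auto.
    - exists (i, (V, K)); simpl. repeat split; auto. }
  apply choice in H. destruct H as [p Hp].
  destruct (precise_refinement (fun x => fst (snd (p x)))) as (W & HW & HWs & HWc & Hlf).
  { intros x; apply Hp. } { intros x. exists x. apply Hp. }
  set (cl := fun (A : X -> Prop) x => forall N, op N -> N x -> exists y, N y /\ A y).
  assert (Hcl : forall A, closed (cl A)).
  { intros A. apply (open_local top). intros x Hx. apply not_all_ex_not in Hx. destruct Hx as [N HN].
    apply imply_to_and in HN. destruct HN as [h1 HN]. apply imply_to_and in HN. destruct HN as [h2 h3].
    exists N. repeat split; auto. }
  assert (Hlfc : locally_finite (op := op) (fun x => cl (W x))).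
  { intros x. destruct (Hlf x) as (N & HN & Hx & l & Hl). exists N. repeat split; auto.
    exists l. intros i (y & Hy & Hi). apply Hl. destruct (Hi N HN Hy) as (z & h1 & h2). eauto. }
  exists (fun i x => exists z, fst (p z) = i /\ cl (W z) x). split; [|split].
  - intros i. apply (closed_lf_union top).
    + apply (locally_finite_sub _ _ Hlfc). tauto.
    + intros z. apply closed_and; auto. apply (closed_const top).
  - intros i x (z & <- & Hz). destruct (Hp z) as (_ & h2 & _ & h4 & h5). apply h5.
    apply NNPP. intros h. destruct (Hz _ h2 h) as (y & hy1 & hy2). apply hy1, h4, HWs, hy2.
  - intros x. destruct (HWc x) as [z Hz]. exists (fst (p z)), z. split; auto.
    intros N _ HNx. eauto.
Qed.

(** Instead of summing to 1, the functions take the value 1 somewhere in the family at every point;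
    this allows fixed thresholds such as 1/2 later. *)
Lemma function_cover {I : Type} (U : I -> X -> Prop) :
  (forall i, op (U i)) -> (forall x, exists i, U i x) ->
  exists f : I -> X -> R, (forall i, real_continuous (f i)) /\
    (forall i x, 0 <= f i x <= 1) /\ (forall i x, 0 < f i x -> U i x) /\
    (forall x, exists i, f i x = 1) /\ locally_finite (op := op) (fun i x => 0 < f i x).
Proof.
  intros HU Hcov.
  destruct (precise_refinement U HU Hcov) as (W & HW & HWU & HWc & Hlf).
  destruct (closed_shrinking W HW HWc) as (F & HF & HFW & HFc).
  assert (H : forall i, exists f : X -> R, real_continuous f /\ (forall x, 0 <= f x <= 1) /\
    (forall x, F i x -> f x = 1) /\ (forall x, 0 < f x -> W i x)).
  { intros i. apply urysohn; auto. }
  apply choice in H. destruct H as [f Hf].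
  exists f. split; [intros; apply Hf|]. split; [intros; apply Hf|].
  split; [|split].
  - intros i x Hx. apply HWU, (Hf i), Hx.
  - intros x. destruct (HFc x) as [i Hi]. exists i. apply (Hf i), Hi.
  - apply (locally_finite_sub _ _ Hlf). intros i x. apply Hf.
Qed.

End Urysohn.

(** * Dimension through pairs of closed sets *)

Section Dimension.
Context {X : Type} {op : (X -> Prop) -> Prop}.
Hypothesis top : is_topology op.
Hypothesis norm : normal_space op.
Notation closed := (is_closed op).

(** The pair at [j] codes the two-element cover of [E] by the complements of [F j] and [G j];
    disjointness says that these cover. *)
Definition closed_pairs (E : X -> Prop) (F G : nat -> X -> Prop) : Prop :=
  forall j, closed (F j) /\ closed (G j) /\ (forall x, F j x -> E x) /\ (forall x, G j x -> E x) /\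
    forall x, F j x -> G j x -> False.

Lemma closed_pairs_l E F G j x : closed_pairs E F G -> F j x -> E x.
Proof. intros H. apply (H j). Qed.

Lemma closed_pairs_r E F G j x : closed_pairs E F G -> G j x -> E x.
Proof. intros H. apply (H j). Qed.

Lemma closed_pairs_disjoint E F G j x : closed_pairs E F G -> F j x -> G j x -> False.
Proof. intros H. apply (H j). Qed.

Definition expands (E : X -> Prop) (d : nat) (F G F' G' : nat -> X -> Prop) : Prop :=
  closed_pairs E F' G' /\ (forall j x, F j x -> F' j x) /\ (forall j x, G j x -> G' j x) /\
  forall x, E x -> exists j, (j <= d)%nat /\ (F' j x \/ G' j x).

(* For closed E this is dim E <= d in the form of the theorem on partitions: the gaps
   E \ (F'_j u G'_j), j <= d, have no common point.  Two-element covers are enough to express it. *)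
Definition dim_le (E : X -> Prop) (d : nat) : Prop :=
  forall F G, closed_pairs E F G -> exists F' G', expands E d F G F' G'.

Lemma dim_le_sub (E E' : X -> Prop) (d : nat) :
  closed E' -> (forall x, E' x -> E x) -> dim_le E d -> dim_le E' d.
Proof.
  intros HE' Hs H F G HFG. destruct (H F G) as (F' & G' & HP & h1 & h2 & h3).
  { intros j. destruct (HFG j) as (a & b & c & e & f). repeat split; auto. }
  exists (fun j x => F' j x /\ E' x), (fun j x => G' j x /\ E' x). split; [|split; [|split]].
  - intros j. destruct (HP j) as (a & b & c & e & f).
    split; [apply closed_and; auto|]. split; [apply closed_and; auto|].
    split; [tauto|]. split; [tauto|]. intros x [? _] [? _]; eauto.
  - intros j x Hx. split; auto. eapply closed_pairs_l; eauto.
  - intros j x Hx. split; auto. eapply closed_pairs_r; eauto.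
  - intros x Hx. destruct (h3 x (Hs x Hx)) as (j & Hj & Hd). exists j. tauto.
Qed.

Lemma dim_le_union {I : Type} (E : I -> X -> Prop) (d : nat) :
  locally_finite (op := op) E ->
  (forall s t x, s <> t -> E s x -> E t x -> False) -> (forall s, dim_le (E s) d) ->
  (forall s, closed (E s)) -> dim_le (fun x => exists s, E s x) d.
Proof.
  intros Hlf Hdis HD HE F G HFG.
  assert (H : forall s, exists p : (nat -> X -> Prop) * (nat -> X -> Prop),
    expands (E s) d (fun j x => F j x /\ E s x) (fun j x => G j x /\ E s x) (fst p) (snd p)).
  { intros s. destruct (HD s (fun j x => F j x /\ E s x) (fun j x => G j x /\ E s x))
      as (F' & G' & H).
    - intros j. destruct (HFG j) as (a & b & c & e & f).
      split; [apply closed_and; auto|]. split; [apply closed_and; auto|].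
      split; [tauto|]. split; [tauto|]. intros x [? _] [? _]; eauto.
    - exists (F', G'); exact H. }
  apply choice in H. destruct H as [p Hp].
  assert (HP : forall s, closed_pairs (E s) (fst (p s)) (snd (p s))) by (intros s; apply Hp).
  exists (fun j x => exists s, fst (p s) j x), (fun j x => exists s, snd (p s) j x).
  split; [|split; [|split]].
  - intros j. split; [|split; [|split; [|split]]].
    + apply closed_lf_union; auto.
      * apply (locally_finite_sub _ _ Hlf). intros s x. apply (HP s j).
      * intros s. apply (HP s j).
    + apply closed_lf_union; auto.
      * apply (locally_finite_sub _ _ Hlf). intros s x. apply (HP s j).
      * intros s. apply (HP s j).
    + intros x [s Hs]. exists s. apply (closed_pairs_l _ _ _ _ _ (HP s) Hs).
    + intros x [s Hs]. exists s. apply (closed_pairs_r _ _ _ _ _ (HP s) Hs).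
    + intros x [s Hs] [t Ht]. destruct (classic (s = t)) as [->|h].
      * destruct (HP t j) as (_ & _ & _ & _ & f). eauto.
      * apply (Hdis s t x h);
          [apply (closed_pairs_l _ _ _ _ _ (HP s) Hs) | apply (closed_pairs_r _ _ _ _ _ (HP t) Ht)].
  - intros j x Hx. destruct (HFG j) as (_ & _ & c & _). destruct (c x Hx) as [s Hs].
    exists s. apply (Hp s). auto.
  - intros j x Hx. destruct (HFG j) as (_ & _ & _ & c & _). destruct (c x Hx) as [s Hs].
    exists s. apply (Hp s). auto.
  - intros x [s Hs]. destruct (Hp s) as (_ & _ & _ & h). destruct (h x Hs) as (j & Hj & [h1|h1]);
    exists j; eauto.
Qed.

(** A sequence that defeats [d] defeats every smaller bound, so the one for the largest failing
    [d <= m] serves all. A single sequence is wanted because it must be fixed before the finite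
    C-property reveals its bound. *)
Lemma inexpandable_pairs (E : X -> Prop) (m : nat) :
  exists F G, closed_pairs E F G /\
    forall d, (d <= m)%nat -> ~ dim_le E d -> ~ exists F' G', expands E d F G F' G'.
Proof.
  assert (Hd : forall d, ~ dim_le E d -> exists F G, closed_pairs E F G /\
    forall d', (d' <= d)%nat -> ~ exists F' G', expands E d' F G F' G').
  { intros d Hd. apply not_all_ex_not in Hd. destruct Hd as [F Hd].
    apply not_all_ex_not in Hd. destruct Hd as [G Hd]. apply imply_to_and in Hd.
    exists F, G. split; [tauto|]. intros d' Hd' (F' & G' & a & b & c & e).
    apply (proj2 Hd). exists F', G'. split; auto. split; auto. split; auto.
    intros x Hx. destruct (e x Hx) as (j & Hj & h). exists j. split; [lia|auto]. }
  induction m as [|m IH].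
  - destruct (classic (dim_le E 0)) as [h|h].
    + exists (fun _ _ => False), (fun _ _ => False). split.
      * intros j. repeat split; try apply (closed_const top); tauto.
      * intros d Hdm Hn. exfalso. apply Hn. replace d with 0%nat by lia. auto.
    + destruct (Hd _ h) as (F & G & h1 & h2). exists F, G. split; auto.
  - destruct (classic (dim_le E (S m))) as [h|h].
    + destruct IH as (F & G & h1 & h2). exists F, G. split; auto.
      intros d Hdm Hn. apply h2; auto.
      assert (d <> S m) by (intros ->; auto). lia.
    + destruct (Hd _ h) as (F & G & h1 & h2). exists F, G. split; auto.
Qed.

Hypothesis finC : finite_C_space op.

(** Each member of the [n]-th disjoint family misses [F n] or [G n]. Sorting the members accordingly
    gives disjoint open sets [P n] and [Q n], and closed parts of these enlarge the pair. *)
Lemma finite_C_pairs (F G : nat -> X -> Prop) : closed_pairs (fun _ => True) F G ->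
  exists k F' G', expands (fun _ => True) k F G F' G'.
Proof.
  intros HFG. destruct finC as [_ HC].
  destruct (HC (fun n => (fun x => ~ F n x) :: (fun x => ~ G n x) :: nil))
    as (k & J & V & HV & Hdis & Hr & Hcov).
  { intros n A [<-|[<-|[]]]; apply HFG. }
  { intros n x. destruct (classic (F n x)) as [h|h].
    - exists (fun x => ~ G n x). split; [simpl; auto|]. intros h'. apply (closed_pairs_disjoint _ _ _ _ _ HFG h h').
    - exists (fun x => ~ F n x). split; [simpl; auto|]. auto. }
  set (P := fun n x => exists j, (forall y, V n j y -> ~ G n y) /\ V n j x).
  set (Q := fun n x => exists j, ~ (forall y, V n j y -> ~ G n y) /\ V n j x).
  assert (HP : forall n, (n <= k)%nat -> op (P n)).
  { intros n Hn. apply (open_exists top). intros j. apply (open_and top); auto. apply (open_const top). }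
  assert (HQ : forall n, (n <= k)%nat -> op (Q n)).
  { intros n Hn. apply (open_exists top). intros j. apply (open_and top); auto. apply (open_const top). }
  assert (HPQ : forall n x, (n <= k)%nat -> P n x -> Q n x -> False).
  { intros n x Hn (i & hi & hix) (j & hj & hjx). destruct (classic (i = j)) as [->|h]; [auto|].
    apply (Hdis n i j Hn h x); auto. }
  assert (HPG : forall n x, P n x -> ~ G n x) by (intros n x (i & hi & hix); auto).
  assert (HQF : forall n x, (n <= k)%nat -> Q n x -> ~ F n x).
  { intros n x Hn (j & hj & hjx). destruct (Hr n j Hn) as (A & [<-|[<-|[]]] & HA); [auto|].
    exfalso. apply hj. auto. }
  (* [K n] lies in the union of [P n] and [Q n], so removing the open set [Q n] leaves a closed
     subset of [P n], and vice versa. *)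
  destruct (shrink_finite top norm (S k) (fun n x => P n x \/ Q n x) (fun _ => True))
    as (K & HK & HKU & HKc).
  { apply (closed_const top True). }
  { intros i Hi. apply (open_or top); [apply HP|apply HQ]; lia. }
  { intros x _. destruct (Hcov x) as (n & j & Hn & Hx). exists n. split; [lia|].
    destruct (classic (forall y, V n j y -> ~ G n y)) as [h|h]; [left|right]; exists j; auto. }
  assert (HKP : forall n x, (n <= k)%nat -> K n x -> P n x \/ Q n x)
    by (intros n x Hn; apply HKU; lia).
  exists k, (fun n x => F n x \/ ((n <= k)%nat /\ K n x) /\ ~ Q n x),
    (fun n x => G n x \/ ((n <= k)%nat /\ K n x) /\ ~ P n x).
  split; [|split; [|split]]; auto.
  - intros n. destruct (HFG n) as (a & b & _ & _ & c).
    assert (Hc : forall (A B : X -> Prop), closed A -> ((n <= k)%nat -> op B) ->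
      closed (fun x => A x \/ ((n <= k)%nat /\ K n x) /\ ~ B x)).
    { intros A B HA HB. destruct (le_dec n k) as [h|h].
      - apply (closed_or top); auto. apply (closed_minus top); auto. apply (closed_and top); auto.
        apply (closed_const top).
      - eapply closed_ext; [exact HA|]. tauto. }
    split; [apply Hc; auto|]. split; [apply Hc; auto|]. split; [auto|]. split; [auto|].
    intros x [h1|[[h0 h1] h2]] [h3|[[h5 h3] h4]].
    + eauto.
    + destruct (HKP n x h5 h3); auto. apply (HQF n x); auto.
    + destruct (HKP n x h0 h1); auto. apply (HPG n x); auto.
    + destruct (HKP n x h0 h1); auto.
  - intros x _. destruct (HKc x I) as (n & Hn & Hx). exists n. split; [lia|].
    destruct (HKP n x) as [h|h]; auto; [lia|left|right]; right; repeat split; auto; try lia;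
    intros h'; apply (HPQ n x); auto; lia.
Qed.

Lemma finite_C_dim_tail (E : nat -> X -> Prop) :
  (forall s, closed (E s)) -> locally_finite (op := op) E ->
  (forall s t x, s <> t -> E s x -> E t x -> False) ->
  exists d, dim_le (fun x => exists s, (d <= s)%nat /\ E s x) d.
Proof.
  intros HE Hlf Hdis.
  assert (H : exists d, forall s, (d <= s)%nat -> dim_le (E s) d).
  { apply NNPP. intros Hn.
    assert (Hbad : forall d, exists s, (d <= s)%nat /\ ~ dim_le (E s) d).
    { intros d. apply NNPP. intros h. apply Hn. exists d. intros s Hs. apply NNPP. intros h'.
      apply h. eauto. }
    assert (H : forall s, exists p : (nat -> X -> Prop) * (nat -> X -> Prop),
      closed_pairs (E s) (fst p) (snd p) /\ forall d, (d <= s)%nat -> ~ dim_le (E s) d ->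
        ~ exists F' G', expands (E s) d (fst p) (snd p) F' G').
    { intros s. destruct (inexpandable_pairs (E s) s) as (F & G & h). exists (F, G). exact h. }
    apply choice in H. destruct H as [p Hp].
    assert (HP : forall s, closed_pairs (E s) (fst (p s)) (snd (p s))) by (intros s; apply Hp).
    destruct (finite_C_pairs (fun j x => exists s, fst (p s) j x) (fun j x => exists s, snd (p s) j x))
      as (k & F' & G' & a & b & c & e).
    { intros j. split; [|split; [|split; [|split]]]; auto.
      - apply (closed_lf_union top).
        + apply (locally_finite_sub _ _ Hlf). intros s x. apply (HP s j).
        + intros s. apply (HP s j).
      - apply (closed_lf_union top).
        + apply (locally_finite_sub _ _ Hlf). intros s x. apply (HP s j).
        + intros s. apply (HP s j).
      - intros x [s Hs] [t Ht]. destruct (classic (s = t)) as [->|h].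
        + destruct (HP t j) as (_ & _ & _ & _ & f). eauto.
        + apply (Hdis s t x h);
          [apply (closed_pairs_l _ _ _ _ _ (HP s) Hs) | apply (closed_pairs_r _ _ _ _ _ (HP t) Ht)]. }
    (* The pairs of [E s] were taken with [m = s], hence they defeat [k] as soon as [k <= s] and the
       dimension of [E s] exceeds [k]; restricting the common expansion to [E s] is the
       contradiction. *)
    destruct (Hbad k) as (s & Hs & Hns). destruct (Hp s) as [_ hp]. apply (hp k Hs Hns).
    exists (fun j x => F' j x /\ E s x), (fun j x => G' j x /\ E s x). split; [|split; [|split]].
    - intros j. destruct (a j) as (a1 & a2 & _ & _ & a3).
      split; [apply (closed_and top); auto|]. split; [apply (closed_and top); auto|].
      split; [tauto|]. split; [tauto|]. intros x [? _] [? _]; eauto.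
    - intros j x Hx. split; [eauto|]. apply (closed_pairs_l _ _ _ _ _ (HP s) Hx).
    - intros j x Hx. split; [eauto|]. apply (closed_pairs_r _ _ _ _ _ (HP s) Hx).
    - intros x Hx. destruct (e x I) as (j & Hj & h). exists j. tauto. }
  destruct H as [d Hd]. exists d. apply dim_le_union.
  - apply (locally_finite_sub _ _ Hlf). tauto.
  - intros s t x h [_ h1] [_ h2]. eauto.
  - intros s. destruct (le_dec d s) as [h|h].
    + apply (dim_le_sub (E s)); auto; [|tauto]. apply (closed_and top); auto. apply (closed_const top).
    + intros F G HFG. exists F, G. split; auto. split; auto. split; auto. intros x [? _]; lia.
  - intros s. apply (closed_and top); auto. apply (closed_const top).
Qed.

(* Every choice t of one member per cover is treated by one application of dim_le to the pairs
   (t j, j); pairs only grow, so the gain survives the later steps. *)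
Lemma dim_le_grid (E : X -> Prop) (d : nat) (HD : dim_le E d) (L : list (nat -> nat)) :
  forall F G : nat -> nat -> X -> Prop, (forall i, closed_pairs E (F i) (G i)) ->
  exists F' G' : nat -> nat -> X -> Prop, (forall i, closed_pairs E (F' i) (G' i)) /\
    (forall i j x, F i j x -> F' i j x) /\ (forall i j x, G i j x -> G' i j x) /\
    forall t x, In t L -> E x -> exists j, (j <= d)%nat /\ (F' (t j) j x \/ G' (t j) j x).
Proof.
  induction L as [|t L IH]; intros F G HFG.
  - exists F, G. repeat split; auto; try apply HFG. intros t x [].
  - destruct (IH F G HFG) as (F1 & G1 & h1 & h2 & h3 & h4).
    destruct (HD (fun j => F1 (t j) j) (fun j => G1 (t j) j)) as (F2 & G2 & k1 & k2 & k3 & k4).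
    { intros j. apply (h1 (t j) j). }
    exists (fun i j x => if Nat.eq_dec i (t j) then F2 j x else F1 i j x),
      (fun i j x => if Nat.eq_dec i (t j) then G2 j x else G1 i j x).
    split; [|split; [|split]].
    + intros i j. destruct (Nat.eq_dec i (t j)); [apply k1|apply h1].
    + intros i j x Hx. destruct (Nat.eq_dec i (t j)) as [->|]; auto.
    + intros i j x Hx. destruct (Nat.eq_dec i (t j)) as [->|]; auto.
    + intros t' x [<-|Ht] Hx.
      * destruct (k4 x Hx) as (j & Hj & h). exists j. split; auto.
        destruct (Nat.eq_dec (t j) (t j)); [auto|lia].
      * destruct (h4 t' x Ht Hx) as (j & Hj & h). exists j. split; auto.
        destruct (Nat.eq_dec (t' j) (t j)) as [e|]; auto. rewrite e in h. destruct h; auto.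
Qed.

(** Only the values at [j <= d] count, so finitely many functions represent all choices;
    [dim_le_grid] runs by induction over such a list. *)
Lemma selectors_list (N d : nat) : exists L : list (nat -> nat), forall t : nat -> nat,
  (forall j, (j <= d)%nat -> (t j < N)%nat) ->
  exists t', In t' L /\ forall j, (j <= d)%nat -> t' j = t j.
Proof.
  induction d as [|d [L HL]].
  - exists (map (fun i _ => i) (seq 0 N)). intros t Ht. exists (fun _ => t 0%nat). split.
    + apply (in_map (fun i (_ : nat) => i)). apply in_seq. specialize (Ht 0%nat). lia.
    + intros j Hj. f_equal; lia.
  - exists (flat_map (fun t => map (fun i j => if Nat.eq_dec j (S d) then i else t j) (seq 0 N)) L).
    intros t Ht. destruct (HL t) as (t' & Hin & He); [auto|].
    exists (fun j => if Nat.eq_dec j (S d) then t (S d) else t' j). split.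
    + apply in_flat_map. exists t'. split; auto.
      apply (in_map (fun i j => if Nat.eq_dec j (S d) then i else t' j)).
      apply in_seq. specialize (Ht (S d)). lia.
    + intros j Hj. destruct (Nat.eq_dec j (S d)) as [->|]; auto. apply He. lia.
Qed.

(** At each point of [E] some [j <= d] has all [i < N] decided, meaning that the point is in [F i j]
    or in [G i j]. Taking the first [i] on the [F] side gives closed pieces that are disjoint for
    fixed [j]. *)
Lemma dim_le_finite_covers (E : X -> Prop) (d N : nat) (U : nat -> nat -> X -> Prop) :
  closed E -> dim_le E d -> (forall j i, op (U j i)) ->
  (forall j x, E x -> exists i, (i < N)%nat /\ U j i x) ->
  exists K : nat -> nat -> X -> Prop, (forall j i, closed (K j i)) /\
    (forall j i x, K j i x -> (i < N)%nat /\ E x /\ U j i x) /\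
    (forall j i i' x, i <> i' -> K j i x -> K j i' x -> False) /\
    (forall x, E x -> exists j i, (j <= d)%nat /\ K j i x).
Proof.
  intros HE HD HU Hcov.
  assert (H : forall j, exists C : nat -> X -> Prop, (forall i, closed (C i)) /\
    (forall i x, (i < N)%nat -> C i x -> U j i x) /\
    (forall x, E x -> exists i, (i < N)%nat /\ C i x)).
  { intros j. apply (shrink_finite top norm); auto. }
  apply choice in H. destruct H as [C HC].
  destruct (selectors_list N d) as [L HL].
  destruct (dim_le_grid E d HD L (fun i j x => ((i < N)%nat /\ C j i x) /\ E x)
    (fun i j x => E x /\ ~ U j i x)) as (F & G & h1 & h2 & h3 & h4).
  { intros i j. destruct (HC j) as (a & b & c). split; [|split; [|split; [|split]]].
    - apply (closed_and top); auto. apply (closed_and top); auto. apply (closed_const top).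
    - apply (closed_minus top); auto.
    - tauto. - tauto.
    - intros x [[e1 e2] _] [_ e3]. eauto. }
  exists (fun j i x => ((i < N)%nat /\ F i j x) /\ forall i', (i' < i)%nat -> G i' j x).
  split; [|split; [|split]].
  - intros j i. apply (closed_and top).
    + apply (closed_and top); [apply (closed_const top)|apply (h1 i j)].
    + apply (closed_forall top). intros i'. apply (closed_imp top). apply (h1 i' j).
  - intros j i x [[Hi HF] _]. destruct (h1 i j) as (_ & _ & e1 & _ & e2).
    split; auto. split; auto. apply NNPP. intros h. apply (e2 x HF), h3. auto.
  - assert (Hlt : forall j i i' x, (i < i')%nat -> F i j x -> (forall i0, (i0 < i')%nat -> G i0 j x) -> False).
    { intros j i i' x Hi HF h. apply (h1 i j) with x; auto. }
    intros j i i' x Hne [[a1 a2] a3] [[b1 b2] b3].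
    destruct (Nat.lt_total i i') as [h|[h|h]]; [eauto|lia|eauto].
  - intros x Hx.
    (* Otherwise every [j <= d] has an undecided index [t j], and the grid property fails for this
       choice [t]. *)
    assert (Hj : exists j, (j <= d)%nat /\ forall i, (i < N)%nat -> F i j x \/ G i j x).
    { apply NNPP. intros Hn.
      assert (Ht : forall j, exists i, (j <= d)%nat -> (i < N)%nat /\ ~ (F i j x \/ G i j x)).
      { intros j. destruct (le_dec j d) as [Hjd|Hjd]; [|exists 0%nat; lia].
        apply NNPP. intros h. apply Hn. exists j. split; auto. intros i Hi. apply NNPP. intros h'.
        apply h. exists i. auto. }
      apply choice in Ht. destruct Ht as [t Ht].
      destruct (HL t) as (t' & Hin & He); [intros j Hj; apply Ht; auto|].
      destruct (h4 t' x Hin Hx) as (j & Hj & h). rewrite He in h; auto.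
      apply (proj2 (Ht j Hj)); auto. }
    destruct Hj as (j & Hj & hj).
    assert (Hex : exists i, ((i < N)%nat /\ F i j x)).
    { destruct (HC j) as (_ & _ & c). destruct (c x Hx) as (i & Hi & h). exists i. split; auto. }
    destruct (dec_inh_nat_subset_has_unique_least_element (fun i => (i < N)%nat /\ F i j x))
      as (i & [[Hi HF] Hmin] & _); auto.
    { intros i. apply classic. }
    exists j, i. split; auto. split; auto. intros i' Hi'.
    destruct (hj i') as [h|h]; [lia| |auto].
    specialize (Hmin i'). destruct Hmin; [split; [lia|auto] | lia | lia].
Qed.

End Dimension.

(** * From finite covers to arbitrary open covers *)

Section Covers.
Context {X : Type} {op : (X -> Prop) -> Prop}.
Hypothesis top : is_topology op.
Hypothesis para : paracompact op.
Hypothesis finC : finite_C_space op.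
Notation closed := (is_closed op).
Let norm : normal_space op := proj1 finC.

Definition exhaustion (C O : nat -> X -> Prop) : Prop :=
  (forall s, closed (C s)) /\ (forall s, op (O s)) /\ (forall s x, C s x -> O s x) /\
  (forall s x, O s x -> C (S s) x) /\ forall x, exists s, C s x.

(** Stopping at [t = s - 2] lets neighbouring slabs overlap; with [s - 1] the points of [O (s - 1)]
    outside [C (s - 1)] would lie in no slab. Slabs of the same parity remain disjoint. *)
Definition slab (C O : nat -> X -> Prop) (s : nat) (x : X) : Prop :=
  C s x /\ forall t, (t + 2 <= s)%nat -> ~ O t x.

Section Exhaustion.
Context {C O : nat -> X -> Prop}.
Hypothesis HCO : exhaustion C O.

Lemma exhaustion_mono s t x : (s <= t)%nat -> C s x -> C t x.
Proof. destruct HCO as (_ & _ & h1 & h2 & _). intros Hst. induction Hst; auto. Qed.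

Lemma slab_closed s : closed (slab C O s).
Proof.
  apply (closed_and top); [apply HCO|]. apply (closed_forall top). intros t.
  apply (closed_imp top). apply closed_not_open. apply HCO.
Qed.

Lemma slab_locally_finite : locally_finite (op := op) (slab C O).
Proof.
  intros x. destruct HCO as (_ & h0 & h1 & _ & h2). destruct (h2 x) as [m Hm].
  exists (O m). repeat split; auto. exists (seq 0 (m + 2)). intros s (y & Hy & _ & Hs).
  apply in_seq. destruct (le_lt_dec (m + 2) s) as [h|h]; [|lia]. exfalso. apply (Hs m h Hy).
Qed.

Lemma slab_disjoint s t x : (s + 2 <= t)%nat -> slab C O s x -> slab C O t x -> False.
Proof. intros Hst [Hs _] [_ Ht]. apply (Ht s Hst). apply HCO, Hs. Qed.

Lemma slab_above c x : ~ C c x -> exists s, (c < s)%nat /\ slab C O s x.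
Proof.
  intros Hc. pose proof HCO as (_ & _ & _ & h1 & h2).
  destruct (dec_inh_nat_subset_has_unique_least_element (fun s => C s x)) as (s & [Hs Hmin] & _).
  - intros s. apply classic.
  - apply h2.
  - exists s. split.
    + destruct (le_lt_dec s c) as [h|h]; auto. exfalso. apply Hc. eapply exhaustion_mono; eauto.
    + split; auto. intros t Ht HO. specialize (Hmin (S t) (h1 t x HO)). lia.
Qed.

Lemma slab_cover x : exists s, slab C O s x.
Proof.
  destruct (classic (C 0%nat x)) as [h|h].
  - exists 0%nat. split; auto. intros t Ht. lia.
  - destruct (slab_above _ _ h) as (s & _ & Hs). eauto.
Qed.

Lemma slab_parity_locally_finite p : locally_finite (op := op) (fun s => slab C O (2 * s + p)).
Proof.
  intros x. destruct (slab_locally_finite x) as (N & HN & Hx & l & Hl).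
  exists N. repeat split; auto. exists (map (fun n => Nat.div2 (n - p)) l).
  intros s Hs. apply in_map_iff. exists (2 * s + p)%nat. split; [|apply Hl; exact Hs].
  replace (2 * s + p - p)%nat with (2 * s)%nat by lia. apply Nat.div2_double.
Qed.

Lemma slab_parity_disjoint p s t x :
  s <> t -> slab C O (2 * s + p) x -> slab C O (2 * t + p) x -> False.
Proof.
  intros Hst h1 h2. destruct (Nat.lt_total s t) as [h|[h|h]]; auto;
  [eapply slab_disjoint; [|exact h1|exact h2]|eapply slab_disjoint; [|exact h2|exact h1]]; lia.
Qed.

End Exhaustion.

Lemma cover_exhaustion (U : nat -> X -> Prop) :
  (forall i, op (U i)) -> (forall x, exists i, U i x) ->
  exists C O, exhaustion C O /\ forall s x, C s x -> exists i, (i <= s)%nat /\ U i x.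
Proof.
  intros HU Hcov.
  destruct (function_cover top norm para U HU Hcov) as (f & h1 & h2 & h3 & h4 & _).
  assert (Hpos : forall n, 0 < / INR (S n)) by (intros n; apply Rinv_0_lt_compat, lt_0_INR; lia).
  exists (fun s x => exists m, (m < S s)%nat /\ / INR (S s) <= f m x),
    (fun s x => exists m, (m < S s)%nat /\ / INR (S (S s)) < f m x).
  split; [split; [|split; [|split; [|split]]]|].
  - intros s. apply (closed_exists_lt top). intros m _. apply closed_ge, h1.
  - intros s. apply (open_exists top). intros m. apply (open_and top); [apply (open_const top)|].
    apply h1.
  - intros s x (m & Hm & Hx). exists m. split; auto. eapply Rlt_le_trans; [|exact Hx].
    apply Rinv_lt_contravar; [apply Rmult_lt_0_compat; apply lt_0_INR; lia|apply lt_INR; lia].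
  - intros s x (m & Hm & Hx). exists m. split; [lia|lra].
  - intros x. destruct (h4 x) as [m Hm]. exists m, m. split; [lia|]. rewrite Hm.
    replace 1 with (/ 1) by apply Rinv_1. apply Rinv_le_contravar; [lra|]. apply (le_INR 1). lia.
  - intros s x (m & Hm & Hx). exists m. split; [lia|]. apply h3. specialize (Hpos s). lra.
Qed.

(** Two exhaustions intersect in an exhaustion; iterating this serves finitely many covers at
    once. *)
Lemma covers_exhaustion (n : nat) (U : nat -> nat -> X -> Prop) :
  (forall j i, op (U j i)) -> (forall j x, exists i, U j i x) ->
  exists C O, exhaustion C O /\
    forall j s x, (j < n)%nat -> C s x -> exists i, (i <= s)%nat /\ U j i x.
Proof.
  intros HU Hcov. induction n as [|n (C1 & O1 & H1 & K1)].
  - destruct (cover_exhaustion (U 0%nat)) as (C & O & H & _); auto.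
    exists C, O. split; auto. intros; lia.
  - destruct (cover_exhaustion (U n)) as (C2 & O2 & H2 & K2); auto.
    exists (fun s x => C1 s x /\ C2 s x), (fun s x => O1 s x /\ O2 s x). split.
    + split; [|split; [|split; [|split]]].
      * intros s. apply (closed_and top); [apply H1|apply H2].
      * intros s. apply (open_and top); [apply H1|apply H2].
      * intros s x [a b]. split; [apply H1|apply H2]; auto.
      * intros s x [a b]. split; [apply H1|apply H2]; auto.
      * intros x. pose proof H1 as (_ & _ & _ & _ & c1). pose proof H2 as (_ & _ & _ & _ & c2).
        destruct (c1 x) as [s Hs]. destruct (c2 x) as [t Ht]. exists (Nat.max s t).
        split; [apply (exhaustion_mono H1 s)|apply (exhaustion_mono H2 t)]; auto; lia.
    + intros j s x Hj [a b]. destruct (Nat.eq_dec j n) as [->|h]; auto.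
      apply K1; auto. lia.
Qed.

(** Only the families in the window from [m] to [n - 1] must cover [A], so consecutive windows can
    be spent on different parts of the space. *)
Definition disjointly_covered {I : Type} (U : nat -> I -> X -> Prop) (A : X -> Prop)
  (m n : nat) : Prop :=
  exists V : nat -> I -> X -> Prop, (forall j i, op (V j i)) /\
    (forall j i x, V j i x -> U j i x) /\
    (forall j i i' x, i <> i' -> V j i x -> V j i' x -> False) /\
    forall x, A x -> exists j i, (m <= j < n)%nat /\ V j i x.

Lemma disjointly_covered_or {I : Type} (U : nat -> I -> X -> Prop) (A B : X -> Prop) (m n p : nat) :
  (m <= n <= p)%nat -> disjointly_covered U A m n -> disjointly_covered U B n p ->
  disjointly_covered U (fun x => A x \/ B x) m p.
Proof.
  intros Hmnp (V & a1 & a2 & a3 & a4) (W & b1 & b2 & b3 & b4).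
  exists (fun j i => if lt_dec j n then V j i else W j i). split; [|split; [|split]].
  - intros j i. destruct (lt_dec j n); auto.
  - intros j i x. destruct (lt_dec j n); auto.
  - intros j i i' x. destruct (lt_dec j n); eauto.
  - intros x [Hx|Hx].
    + destruct (a4 x Hx) as (j & i & Hj & h). exists j, i. split; [lia|].
      destruct (lt_dec j n); [auto|lia].
    + destruct (b4 x Hx) as (j & i & Hj & h). exists j, i. split; [lia|].
      destruct (lt_dec j n); [lia|auto].
Qed.

Lemma disjointly_covered_sub {I : Type} (U : nat -> I -> X -> Prop) (A B : X -> Prop) (m n : nat) :
  (forall x, A x -> B x) -> disjointly_covered U B m n -> disjointly_covered U A m n.
Proof. intros H (V & a1 & a2 & a3 & a4). exists V. repeat split; eauto. Qed.

(** The number [N s] of cover members may grow with [s] while [d + 1] families still suffice: the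
    pieces are disjoint, so the sets found on them can be united over [s] for each family and
    index. *)
Lemma dim_le_discrete_covered (E : nat -> X -> Prop) (N : nat -> nat) (d m : nat)
  (U : nat -> nat -> X -> Prop) :
  (forall s, closed (E s)) -> locally_finite (op := op) E ->
  (forall s t x, s <> t -> E s x -> E t x -> False) -> (forall s, dim_le (op := op) (E s) d) ->
  (forall j i, op (U j i)) ->
  (forall s j x, (j < m + S d)%nat -> E s x -> exists i, (i < N s)%nat /\ U j i x) ->
  disjointly_covered U (fun x => exists s, E s x) m (m + S d).
Proof.
  intros HE Hlf Hdis HD HU Hcov.
  (* [Nat.min j d] repeats the last cover beyond [d], which keeps every index below [m + S d], where
     [Hcov] applies. *)
  assert (H : forall s, exists K : nat -> nat -> X -> Prop, (forall j i, closed (K j i)) /\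
    (forall j i x, K j i x -> (i < N s)%nat /\ E s x /\ U (m + Nat.min j d)%nat i x) /\
    (forall j i i' x, i <> i' -> K j i x -> K j i' x -> False) /\
    (forall x, E s x -> exists j i, (j <= d)%nat /\ K j i x)).
  { intros s. apply (dim_le_finite_covers top norm (E s) d (N s)
      (fun j i => U (m + Nat.min j d)%nat i)); auto.
    intros j x Hx. apply Hcov; auto. lia. }
  apply choice in H. destruct H as [K HK].
  assert (HV : forall j, exists V : nat -> X -> Prop, (forall i, op (V i)) /\
    (forall i x, (exists s, K s j i x) -> V i x) /\
    (forall i x, V i x -> U (m + Nat.min j d)%nat i x) /\
    (forall i i' x, i <> i' -> V i x -> V i' x -> False)).
  { intros j. apply (expand_discrete top norm).
    - intros i. apply (closed_lf_union top).
      + apply (locally_finite_sub _ _ Hlf). intros s x Hx. apply (HK s) in Hx. tauto.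
      + intros s. apply HK.
    (* Index [i] occurs over [E s] only for [i < N s], so the finitely many pieces near [x] involve
       finitely many indices. *)
    - intros x. destruct (Hlf x) as (M & HM & HMx & l & Hl). exists M. repeat split; auto.
      exists (flat_map (fun s => seq 0 (N s)) l). intros i (y & Hy & s & Hs).
      apply (HK s) in Hs. apply in_flat_map. exists s. split.
      + apply Hl. exists y. tauto.
      + apply in_seq. lia.
    - auto.
    - intros i x (s & Hs). apply (HK s) in Hs. tauto.
    - intros i i' x Hne (s & Hs) (t & Ht). destruct (Nat.eq_dec s t) as [->|h].
      + destruct (HK t) as (_ & _ & h & _). eauto.
      + apply (HK s) in Hs. apply (HK t) in Ht. apply (Hdis s t x); tauto. }
  apply choice in HV. destruct HV as [V HV].
  exists (fun j i x => (m <= j < m + S d)%nat /\ V (j - m)%nat i x). split; [|split; [|split]].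
  - intros j i. apply (open_and top); [apply (open_const top)|apply HV].
  - intros j i x [Hj Hx]. apply (HV (j - m)%nat) in Hx.
    replace (m + Nat.min (j - m) d)%nat with j in Hx by lia. auto.
  - intros j i i' x Hne [_ h1] [_ h2]. destruct (HV (j - m)%nat) as (_ & _ & _ & h). eauto.
  - intros x [s Hs]. destruct (HK s) as (_ & _ & _ & h). destruct (h x Hs) as (j & i & Hj & Hx).
    exists (m + j)%nat, i. split; [lia|]. split; [lia|]. replace (m + j - m)%nat with j by lia.
    apply (HV j). eauto.
Qed.

(** The even slabs of a common exhaustion use [d + 1] families and the odd slabs the next [d + 1];
    each slab needs only finitely many members of each cover. *)
Lemma dim_le_covered (E : X -> Prop) (d m : nat) (U : nat -> nat -> X -> Prop) :
  closed E -> dim_le (op := op) E d -> (forall j i, op (U j i)) ->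
  (forall j x, exists i, U j i x) -> exists n, (m <= n)%nat /\ disjointly_covered U E m n.
Proof.
  intros HE HD HU Hcov.
  destruct (covers_exhaustion (m + 2 * S d) U HU Hcov) as (C & O & HCO & HC).
  assert (H : forall p m', (m' + S d <= m + 2 * S d)%nat ->
    disjointly_covered U (fun x => exists s, slab C O (2 * s + p) x /\ E x) m' (m' + S d)).
  { intros p m' Hm'.
    assert (Hcl : forall s, closed (fun x => slab C O (2 * s + p) x /\ E x))
      by (intros s; apply (closed_and top); auto; apply slab_closed; auto).
    apply (dim_le_discrete_covered _ (fun s => S (2 * s + p))); auto.
    - apply (locally_finite_sub _ _ (slab_parity_locally_finite HCO p)). tauto.
    - intros s t x Hne [h1 _] [h2 _]. apply (slab_parity_disjoint HCO p s t x); auto.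
    - intros s. apply (dim_le_sub top E); auto. tauto.
    - intros s j x Hj [[Hs _] _]. destruct (HC j (2 * s + p)%nat x ltac:(lia) Hs) as (i & Hi & h).
      exists i. split; [lia|auto]. }
  exists (m + S d + S d)%nat. split; [lia|].
  eapply disjointly_covered_sub;
    [|apply (disjointly_covered_or U) with (n := (m + S d)%nat);
       [lia|apply (H 0%nat); lia|apply (H 1%nat); lia]].
  intros x Hx. destruct (slab_cover HCO x) as [s Hs].
  destruct (Nat.Even_or_Odd s) as [[t ->]|[t ->]]; [left|right]; exists t; split; auto.
  rewrite Nat.add_0_r. auto.
Qed.

(** The [n]-th cover is made finite: its members up to [c n], together with the complement of the
    [c n]-th closed set, which lies in a tail of finite dimension. The finite C-property gives some
    [k]. Members inside a [U n i] are kept; the others lie in the tails of the levels up to [k],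
    which are covered by families of index beyond [k]. *)
Lemma finite_C_countable_covers (U : nat -> nat -> X -> Prop) :
  (forall j i, op (U j i)) -> (forall j x, exists i, U j i x) ->
  exists n, disjointly_covered U (fun _ => True) 0 n.
Proof.
  intros HU Hcov.
  assert (H : forall n, exists p : (nat -> X -> Prop) * (nat -> X -> Prop),
    exhaustion (fst p) (snd p) /\
    forall s x, fst p s x -> exists i, (i <= s)%nat /\ U n i x).
  { intros n. destruct (cover_exhaustion (U n)) as (C & O & h); auto. exists (C, O); exact h. }
  apply choice in H. destruct H as [CO HCO].
  set (sl := fun n => slab (fst (CO n)) (snd (CO n))).
  assert (Hd : forall p n, exists d, dim_le (op := op) (fun x => exists s, (d <= s)%nat /\
    sl n (2 * s + p)%nat x) d).
  { intros p n. apply (finite_C_dim_tail top norm finC (fun s => sl n (2 * s + p)%nat)).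
    - intros s. apply slab_closed, HCO.
    - apply slab_parity_locally_finite, HCO.
    - intros s t x. apply slab_parity_disjoint, HCO. }
  assert (Hd0 := choice _ (Hd 0%nat)). assert (Hd1 := choice _ (Hd 1%nat)). clear Hd.
  destruct Hd0 as [d0 Hd0]. destruct Hd1 as [d1 Hd1].
  (* A slab beyond [c n] has index [2 * t] or [2 * t + 1] with [t] at least [d0 n] and at least
     [d1 n]. *)
  set (c := fun n => (2 * (d0 n + d1 n) + 1)%nat).
  set (tail := fun n x => (exists s, (d0 n <= s)%nat /\ sl n (2 * s + 0)%nat x) \/
    (exists s, (d1 n <= s)%nat /\ sl n (2 * s + 1)%nat x)).
  assert (Htail : forall n x, ~ fst (CO n) (c n) x -> tail n x).
  { intros n x Hx. destruct (slab_above (proj1 (HCO n)) _ _ Hx) as (s & Hs & Hsl).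
    unfold c in Hs. destruct (Nat.Even_or_Odd s) as [[t Ht]|[t Ht]]; [left|right]; exists t;
    (split; [lia|]); unfold sl; [rewrite Nat.add_0_r|]; rewrite <- Ht; exact Hsl. }
  assert (Htailcl : forall p n d, closed (fun x => exists s, (d <= s)%nat /\ sl n (2 * s + p)%nat x)).
  { intros p n d. apply (closed_lf_union top).
    - apply (locally_finite_sub _ _ (slab_parity_locally_finite (proj1 (HCO n)) p)). unfold sl. tauto.
    - intros s. apply (closed_and top); [apply (closed_const top)|]. apply slab_closed, HCO. }
  destruct (proj2 finC (fun n => (fun x => ~ fst (CO n) (c n) x) :: map (U n) (seq 0 (S (c n)))))
    as (k & J & V & HV & Hdis & Hr & HVc).
  { intros n A [<-|HA].
    - apply open_not_closed. destruct (HCO n) as [(h & _) _]. apply h.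
    - apply in_map_iff in HA. destruct HA as (i & <- & _). auto. }
  { intros n x. destruct (classic (fst (CO n) (c n) x)) as [h|h].
    - destruct (proj2 (HCO n) _ _ h) as (i & Hi & Hx). exists (U n i). split; auto.
      right. apply in_map, in_seq. lia.
    - exists (fun x => ~ fst (CO n) (c n) x). split; [left; auto|auto]. }
  (* Members inside no [U n i] get the default index 0; they are left to the tails. *)
  assert (Hr' : forall n, exists r : J n -> nat, forall j, (exists i, forall x, V n j x -> U n i x) ->
    forall x, V n j x -> U n (r j) x).
  { intros n. apply (choice (fun j i => (exists i, forall x, V n j x -> U n i x) ->
      forall x, V n j x -> U n i x)). intros j.
    destruct (classic (exists i, forall x, V n j x -> U n i x)) as [[i Hi]|h].
    - exists i. auto.
    - exists 0%nat. tauto. }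
  assert (Hmain : disjointly_covered U
    (fun x => exists n j, (n <= k)%nat /\ (exists i, forall x, V n j x -> U n i x) /\ V n j x) 0 (S k)).
  { assert (Hr2 : exists r : forall n, J n -> nat, forall n j,
      (exists i, forall x, V n j x -> U n i x) -> forall x, V n j x -> U n (r n j) x).
    { exists (fun n => proj1_sig (constructive_indefinite_description _ (Hr' n))).
      intros n. destruct (constructive_indefinite_description _ (Hr' n)) as [r h]. exact h. }
    destruct Hr2 as [r Hr2].
    (* The constant conjunct empties the levels beyond [k], where [V n j] need not be open. *)
    exists (fun n i x => exists j, ((n <= k)%nat /\ (exists i, forall x, V n j x -> U n i x) /\
      r n j = i) /\ ((n <= k)%nat -> V n j x)). split; [|split; [|split]].
    - intros n i. apply (open_exists top). intros j. apply (open_and top); [apply (open_const top)|].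
      destruct (le_dec n k).
      + apply (open_imp top). auto.
      + eapply open_ext; [apply (open_const top True)|]. tauto.
    - intros n i x (j & (h1 & h2 & <-) & h3). auto.
    - intros n i i' x Hne (j & (h1 & h2 & h3) & h4) (j' & (k1 & k2 & k3) & k4).
      apply (Hdis n j j' h1) with x; auto. congruence.
    - intros x (n & j & Hn & Hex & Hx). exists n, (r n j). split; [lia|]. exists j. auto. }
  assert (Htails : forall n m, exists p, (m <= p)%nat /\
    disjointly_covered U (fun x => exists n', (n' <= n)%nat /\ tail n' x) m p).
  { assert (Hone : forall n m, exists p, (m <= p)%nat /\ disjointly_covered U (tail n) m p).
    { intros n m.
      destruct (dim_le_covered _ _ m U (Htailcl 0%nat n (d0 n)) (Hd0 n) HU Hcov) as (p & Hp & h1).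
      destruct (dim_le_covered _ _ p U (Htailcl 1%nat n (d1 n)) (Hd1 n) HU Hcov) as (q & Hq & h2).
      exists q. split; [lia|]. apply (disjointly_covered_or U _ _ m p q); auto. }
    induction n as [|n IH]; intros m.
    - destruct (Hone 0%nat m) as (p & Hp & h). exists p. split; auto.
      eapply disjointly_covered_sub; [|exact h]. intros x (n & Hn & Hx).
      replace n with 0%nat in Hx by lia. auto.
    - destruct (IH m) as (p & Hp & h1). destruct (Hone (S n) p) as (q & Hq & h2).
      exists q. split; [lia|].
      refine (disjointly_covered_sub U _ _ m q _ (disjointly_covered_or U _ _ m p q (conj Hp Hq) h1 h2)).
      intros x (n' & Hn' & Hx). destruct (Nat.eq_dec n' (S n)) as [->|h]; [right; auto|left].
      exists n'. split; [lia|auto]. }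
  destruct (Htails k (S k)) as (q & Hq & Ht). exists q.
  refine (disjointly_covered_sub U _ _ 0 q _
    (disjointly_covered_or U _ _ 0 (S k) q (conj (Nat.le_0_l _) Hq) Hmain Ht)).
  intros x _. destruct (HVc x) as (n & j & Hn & Hx).
  destruct (classic (exists i, forall x, V n j x -> U n i x)) as [h|h].
  - left. exists n, j. auto.
  - right. exists n. split; auto. apply Htail. destruct (Hr n j Hn) as (A & [<-|HA] & HVA); auto.
    exfalso. apply h. apply in_map_iff in HA. destruct HA as (i & <- & _). eauto.
Qed.

Lemma open_lt (f g : X -> R) : real_continuous (op := op) f -> real_continuous (op := op) g ->
  op (fun x => f x < g x).
Proof.
  intros Hf Hg. apply (open_local top). intros x Hx.
  exists (fun y => f y < (f x + g x) / 2 /\ (f x + g x) / 2 < g y). split; [|split].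
  - apply (open_and top); [apply Hf|apply Hg].
  - lra.
  - intros y. lra.
Qed.

Lemma nodup_subset {I : Type} (l : list I) (P : I -> Prop) : (forall i, P i -> In i l) ->
  exists l', NoDup l' /\ forall i, P i <-> In i l'.
Proof.
  revert P. induction l as [|a l IH]; intros P HP.
  - exists nil. split; [constructor|]. intros i. split; [apply HP|intros []].
  - destruct (IH (fun i => P i /\ i <> a)) as (l' & h1 & h2).
    { intros i [Hi Hne]. destruct (HP i Hi); [congruence|auto]. }
    destruct (classic (P a)) as [Ha|Ha].
    + exists (a :: l'). split.
      * constructor; auto. intros h. apply h2 in h. tauto.
      * intros i. simpl. rewrite <- h2. destruct (classic (a = i)) as [->|h]; split; auto; tauto.
    + exists l'. split; auto. intros i. rewrite <- h2. split; [|tauto]. intros Hi. split; auto.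
      congruence.
Qed.

(* Milnor's trick: the pieces of level m are the sets where the functions of some m indices
   strictly exceed all the others, i.e. open stars of barycentres in the nerve. *)
Lemma countable_disjoint_pieces {I : Type} (U : I -> X -> Prop) :
  (forall i, op (U i)) -> (forall x, exists i, U i x) ->
  exists P : nat -> I -> X -> Prop, (forall m i, op (P m i)) /\ (forall m i x, P m i x -> U i x) /\
    (forall m i i' x, i <> i' -> P m i x -> P m i' x -> False) /\ forall x, exists m i, P m i x.
Proof.
  intros HU Hcov.
  destruct (function_cover top norm para U HU Hcov) as (f & h1 & h2 & h3 & h4 & h5).
  set (W := fun (S : I -> Prop) x => (forall i, S i -> 0 < f i x) /\
    forall i i', S i -> ~ S i' -> f i' x < f i x).
  set (card := fun (S : I -> Prop) m => exists l, NoDup l /\ length l = m /\ forall i, S i <-> In i l).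
  (* The representative of [S] names a member of the cover that contains [W S]; since it depends on
     [S] alone, different names mean different index sets. *)
  assert (Hr : forall S : I -> Prop, exists o : option I, (exists i, S i) -> exists i, o = Some i /\ S i).
  { intros S. destruct (classic (exists i, S i)) as [[i Hi]|h].
    - exists (Some i). eauto.
    - exists None. tauto. }
  apply choice in Hr. destruct Hr as [r Hr].
  assert (HW : forall S m, card S m -> op (W S)).
  (* Near [x] no function outside the finite list [l'] is positive, so finitely many strict
     inequalities imply all of them. *)
  { intros S m (l & _ & _ & Hl). apply (open_local top). intros x [Hx1 Hx2].
    destruct (h5 x) as (N & HN & HNx & l' & Hl').
    exists (fun y => N y /\ (forall i, In i l -> 0 < f i y) /\
      forall i, In i l -> forall i', In i' l' -> ~ S i' -> f i' y < f i y). split; [|split].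
    - apply (open_and top); auto. apply (open_and top).
      + apply (open_forall_list top). intros; apply h1.
      + apply (open_forall_list top). intros. apply (open_forall_list top). intros.
        apply (open_imp top). apply open_lt; auto.
    - split; auto. split.
      + intros i Hi. apply Hx1, Hl, Hi.
      + intros i Hi i' _ Hi'. apply Hx2; auto. apply Hl; auto.
    - intros y (Hy1 & Hy2 & Hy3). split.
      + intros i Hi. apply Hy2, Hl, Hi.
      + intros i i' Hi Hi'. apply Hl in Hi. destruct (classic (In i' l')) as [h|h]; [auto|].
        destruct (Rlt_dec 0 (f i' y)) as [h0|h0]; [exfalso; apply h, Hl'; eauto|].
        specialize (Hy2 i Hi). lra. }
  exists (fun m i x => exists S : I -> Prop, (card S m /\ r S = Some i /\ S i) /\ (card S m -> W S x)).
  split; [|split; [|split]].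
  - intros m i. apply (open_exists top). intros S. apply (open_and top); [apply (open_const top)|].
    destruct (classic (card S m)) as [h|h].
    + apply (open_imp top). eauto.
    + eapply open_ext; [apply (open_const top True)|]. tauto.
  - intros m i x (S & (h & _ & Hi) & Hx). apply h3. apply (Hx h); auto.
  - intros m i i' x Hne (S & (c1 & r1 & _) & W1) (T & (c2 & r2 & _) & W2).
    specialize (W1 c1). specialize (W2 c2).
    (* Distinct index sets of equal size are incomparable, so each contains an index whose function
       would have to exceed one of the other set. *)
    assert (Hinc : forall S T, card S m -> card T m -> (forall i, S i -> T i) -> forall i, T i -> S i).
    { clear. intros S T (l & a & b & c) (l' & a' & b' & c') H i Hi.
      apply c. apply (NoDup_length_incl a (l' := l')); [lia| |apply c', Hi].
      intros k Hk. apply c', H, c, Hk. }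
    assert (HST : S <> T) by congruence.
    destruct (classic (forall i, S i -> T i)) as [h|h].
    + apply HST. extensionality a. apply propositional_extensionality. split; auto.
      apply (Hinc S T); auto.
    + destruct (classic (forall i, T i -> S i)) as [h'|h'].
      * apply h. apply (Hinc T S); auto.
      * apply not_all_ex_not in h. destruct h as [a ha]. apply imply_to_and in ha.
        apply not_all_ex_not in h'. destruct h' as [b hb]. apply imply_to_and in hb.
        destruct W1 as [_ W1]. destruct W2 as [_ W2].
        assert (f b x < f a x) by (apply W1; tauto). assert (f a x < f b x) by (apply W2; tauto). lra.
  - intros x. destruct (h5 x) as (N & HN & HNx & l & Hl).
    set (S := fun i => 0 < f i x).
    destruct (nodup_subset l S) as (l' & n1 & n2); [intros i Hi; apply Hl; eauto|].
    destruct (Hr S) as (i & Hi & HSi).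
    { destruct (h4 x) as [i Hi]. exists i. unfold S. lra. }
    exists (length l'), i, S. split; [split; [|auto]|].
    + exists l'. auto.
    + intros _. split; [auto|]. intros a b Ha Hb. unfold S in *. lra.
Qed.

(** The pieces [P j m i] are united over [i] into a countable cover; the families found for it are
    cut again by the [P j m i]. Disjointness over [m] and over [i] combine. *)
Lemma finite_C_arbitrary_covers {I : Type} (U : nat -> I -> X -> Prop) :
  (forall j i, op (U j i)) -> (forall j x, exists i, U j i x) ->
  exists n, disjointly_covered U (fun _ => True) 0 n.
Proof.
  intros HU Hcov.
  assert (H : forall j, exists P : nat -> I -> X -> Prop, (forall m i, op (P m i)) /\
    (forall m i x, P m i x -> U j i x) /\
    (forall m i i' x, i <> i' -> P m i x -> P m i' x -> False) /\ forall x, exists m i, P m i x).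
  { intros j. apply countable_disjoint_pieces; auto. }
  apply choice in H. destruct H as [P HP].
  destruct (finite_C_countable_covers (fun j m x => exists i, P j m i x)) as (n & V & a & b & c & d).
  { intros j m. apply (open_exists top). intros i. apply HP. }
  { intros j x. apply HP. }
  exists n, (fun j i x => exists m, V j m x /\ P j m i x). split; [|split; [|split]].
  - intros j i. apply (open_exists top). intros m. apply (open_and top); auto. apply HP.
  - intros j i x (m & _ & h). apply (HP j) in h. auto.
  - intros j i i' x Hne (m & h1 & h2) (m' & h3 & h4). destruct (Nat.eq_dec m m') as [->|h].
    + destruct (HP j) as (_ & _ & h & _). eauto.
    + eauto.
  - intros x _. destruct (d x) as (j & m & Hj & Hx); auto. destruct (b j m x Hx) as [i Hi].
    exists j, i. eauto.
Qed.

End Covers.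

(** * Contractions obtained from the set-valued mapping *)

Section Approximation.
Context {X Y : Type} {op : (X -> Prop) -> Prop} {rho : Y -> Y -> R} {phi : X -> Y -> Prop}.
Hypothesis top : is_topology op.
Hypothesis para : paracompact op.
Hypothesis finC : finite_C_space op.
Hypothesis metric : is_metric rho.
Hypothesis phi_cont : rho_continuous op rho phi.
Hypothesis phi_UV : forall x, uniformly_UV_omega rho (phi x).

Definition ample (Phi : X -> Y -> Prop) : Prop :=
  forall z, exists N c, op N /\ N z /\ 0 < c /\
    forall x y, N x -> Onbhd rho c (phi x) y -> Phi x y.

(** [S z] and [T z] depend on the index [z] and not on the point, so the null-homotopies concern
    fixed sets while [x] ranges over [W z]. *)
Definition contracting_cover (Phi Phi' : X -> Y -> Prop) (W : X -> X -> Prop)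
  (S T : X -> Y -> Prop) : Prop :=
  (forall z, op (W z)) /\ (forall x, exists z, W z x) /\
  (forall z x y, W z x -> Phi' x y -> S z y) /\ (forall z x y, W z x -> T z y -> Phi x y) /\
  (forall z y, S z y -> T z y) /\ forall z, hook_omega rho (S z) (T z).

Lemma Onbhd_trans (A B : Y -> Prop) (r s t : R) (y : Y) : r + s <= t ->
  subset A (Onbhd rho s B) -> Onbhd rho r A y -> Onbhd rho t B y.
Proof.
  intros Hrs HAB (q & Hq & Hy). destruct (HAB q Hq) as (q' & Hq' & Hqq).
  exists q'. split; auto. destruct metric as (_ & _ & _ & Htri).
  specialize (Htri y q q'). lra.
Qed.

Lemma ample_contracting_cover (Phi : X -> Y -> Prop) : ample Phi ->
  exists Phi', ample Phi' /\ exists W S T, contracting_cover Phi Phi' W S T.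
Proof.
  intros Hc.
  assert (H : forall z, exists q : (X -> Prop) * (R * R), op (fst q) /\ fst q z /\
    0 < fst (snd q) <= snd (snd q) /\
    hook_omega rho (Onbhd rho (fst (snd q)) (phi z)) (Onbhd rho (snd (snd q)) (phi z)) /\
    (forall x y, fst q x -> Onbhd rho (snd (snd q)) (phi z) y -> Phi x y) /\
    (forall x y, fst q x -> Onbhd rho (fst (snd q) / 2) (phi x) y -> Onbhd rho (fst (snd q)) (phi z) y)).
  { intros z. destruct (Hc z) as (N & c & HN & HNz & Hcpos & HPhi).
    (* [T] gets radius c/2 and [S] radius d. When [phi x] and [phi z] are d/2-close, c/2 + d/2 <= c
       puts [T] into [Phi x], and d/2 + d/2 = d puts the d/2-neighbourhood of [phi x] into [S]. *)
    destruct (phi_UV z (c / 2)) as (d & [Hd1 Hd2] & Hhook); [lra|].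
    destruct (phi_cont (d / 2) ltac:(lra) z) as (V & HV & HVz & HVp).
    exists (fun x => N x /\ V x, (d, c / 2)). simpl. repeat split; auto; try lra.
    - apply (open_and top); auto.
    - intros x y [h1 h2] Hy. apply HPhi; auto.
      apply (Onbhd_trans (phi z) (phi x) (c / 2) (d / 2) c); auto; [lra|apply HVp; auto].
    - intros x y [h1 h2] Hy.
      apply (Onbhd_trans (phi x) (phi z) (d / 2) (d / 2) d); auto; [lra|apply HVp; auto]. }
  apply choice in H. destruct H as [q Hq].
  destruct (precise_refinement top para (fun z => fst (q z))) as (W & HW & HWq & HWc & Hlf).
  { intros z; apply Hq. } { intros z. exists z. apply Hq. }
  (* The intersection over all [z] with [W z x] lies in each of these [S z]; local finiteness of [W]
     leaves a positive radius, so it is again ample. *)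
  exists (fun x y => forall z, W z x -> Onbhd rho (fst (snd (q z))) (phi z) y). split.
  - intros z. destruct (Hlf z) as (N & HN & HNz & l & Hl).
    assert (Hmin : exists c, 0 < c /\ forall i, In i l -> c <= fst (snd (q i)) / 2).
    { clear Hl. induction l as [|a l (c & Hc0 & Hcl)].
      - exists 1. split; [lra|]. intros i [].
      - destruct (Hq a) as (_ & _ & [Ha _] & _).
        exists (Rmin c (fst (snd (q a)) / 2)). split.
        + apply Rmin_glb_lt; lra.
        + intros i [<-|Hi]; [apply Rmin_r|]. eapply Rle_trans; [apply Rmin_l|auto]. }
    destruct Hmin as (c & Hc0 & Hcl). exists N, c. repeat split; auto.
    intros x y HNx (p & Hp & Hyp) i Hi. apply (proj2 (proj2 (proj2 (proj2 (proj2 (Hq i)))))) with x.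
    + apply HWq, Hi.
    + exists p. split; auto. assert (c <= fst (snd (q i)) / 2) by (apply Hcl, Hl; eauto). lra.
  - exists W, (fun z => Onbhd rho (fst (snd (q z))) (phi z)),
      (fun z => Onbhd rho (snd (snd (q z))) (phi z)).
    split; [auto|]. split; [auto|]. split; [auto|]. split; [|split].
    + intros z x y Hz Hy. apply (proj1 (proj2 (proj2 (proj2 (proj2 (Hq z)))))); auto.
    + intros z y (p & Hp & Hy). exists p. split; auto. destruct (Hq z) as (_ & _ & h & _). lra.
    + intros z. apply Hq.
Qed.

(** Dependent choice: each step needs the ampleness of the previous set. The successor is written
    [1 + n] because [S] is bound to a family of sets. *)
Lemma contracting_covers (Phi : X -> Y -> Prop) : ample Phi ->
  exists (Psi : nat -> X -> Y -> Prop) (W : nat -> X -> X -> Prop) (S T : nat -> X -> Y -> Prop),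
    Psi 0%nat = Phi /\
    forall n, contracting_cover (Psi n) (Psi (1 + n)%nat) (W n) (S n) (T n).
Proof.
  intros HPhi.
  set (next := fun P : {Phi | ample Phi} =>
    let s := constructive_indefinite_description _
      (ample_contracting_cover (proj1_sig P) (proj2_sig P)) in
    exist ample (proj1_sig s) (proj1 (proj2_sig s))).
  set (Q := nat_rect (fun _ => {Phi | ample Phi}) (exist ample Phi HPhi) (fun _ => next)).
  assert (H : forall n, exists q : (X -> X -> Prop) * ((X -> Y -> Prop) * (X -> Y -> Prop)),
    contracting_cover (proj1_sig (Q n)) (proj1_sig (Q (1 + n)%nat)) (fst q) (fst (snd q)) (snd (snd q))).
  { intros n. change (Q (1 + n)%nat) with (next (Q n)). unfold next.
    destruct (constructive_indefinite_description _
      (ample_contracting_cover (proj1_sig (Q n)) (proj2_sig (Q n)))) as (Phi' & h1 & W & S & T & h2).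
    exists (W, (S, T)). exact h2. }
  apply choice in H. destruct H as [q Hq].
  exists (fun n => proj1_sig (Q n)), (fun n => fst (q n)), (fun n => fst (snd (q n))),
    (fun n => snd (snd (q n))).
  split; [reflexivity|exact Hq].
Qed.

Lemma Onbhd_ample (eps : X -> R) : (forall x, 0 < eps x) -> continuous_into op Rmetric eps ->
  ample (fun x => Onbhd rho (eps x) (phi x)).
Proof.
  intros He Hcont z. exists (fun x => eps z / 2 < eps x), (eps z / 2).
  split; [|split; [|split]].
  - apply (Hcont (fun t => eps z / 2 < t)). intros t Ht. exists (t - eps z / 2). split; [lra|].
    intros s Hs. unfold Rmetric in Hs. apply Rabs_def2 in Hs. lra.
  - specialize (He z). lra.
  - specialize (He z). lra.
  - intros x y Hx (p & Hp & Hy). exists p. split; auto. lra.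
Qed.

End Approximation.

(** * Geometric realisations, null-homotopies and cones *)

Notation coordinate_sum l a := (fold_right (fun v acc => a v + acc) 0 l).

Section Realization.
Context {V Y : Type} {rho : Y -> Y -> R}.
Hypothesis metric : is_metric rho.
Implicit Types (simp : (V -> Prop) -> Prop) (a b : V -> R).

Lemma realization_mono simp simp' a :
  simp' (support a) -> in_realization simp a -> in_realization simp' a.
Proof. intros H (h1 & _ & h2). split; auto. Qed.

Lemma coordinate_sum_nonneg a l : (forall v, 0 <= a v) -> 0 <= coordinate_sum l a.
Proof.
  intros H. induction l as [|v l IH]; simpl; [lra|]. specialize (H v). lra.
Qed.

Lemma coordinate_sum_app a l1 l2 :
  coordinate_sum (l1 ++ l2) a = coordinate_sum l1 a + coordinate_sum l2 a.
Proof. induction l1 as [|v l1 IH]; simpl; [lra|]. rewrite IH. lra. Qed.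

Lemma realization_split simp a v : in_realization simp a ->
  exists l, NoDup l /\ (forall w, In w l <-> w <> v /\ a w <> 0) /\ a v + coordinate_sum l a = 1.
Proof.
  intros (h1 & _ & l & Hnd & Hin & Hsum). destruct (classic (In v l)) as [h|h].
  - destruct (in_split v l h) as (l1 & l2 & ->). apply NoDup_remove in Hnd.
    exists (l1 ++ l2). split; [tauto|]. split.
    + intros w. rewrite <- Hin. rewrite !in_app_iff. simpl. split.
      * intros hw. split; [|tauto]. intros ->. apply (proj2 Hnd). apply in_app_iff. auto.
      * intros [hne [?|[?|?]]]; auto. congruence.
    + rewrite coordinate_sum_app in *. simpl in Hsum. lra.
  - exists l. split; auto. split.
    + intros w. rewrite <- Hin. split; [|tauto]. intros hw. split; auto. congruence.
    + assert (a v = 0) by (apply NNPP; intros h'; apply h, Hin, h'). lra.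
Qed.

Lemma realization_bounds simp a v : in_realization simp a -> 0 <= a v <= 1.
Proof.
  intros H. destruct (realization_split simp a v H) as (l & _ & _ & Hs).
  destruct H as (h1 & _). split; auto. pose proof (coordinate_sum_nonneg a l h1). lra.
Qed.

(* Only meaningful for a v <> 1. *)
Definition face_projection (v : V) a : V -> R :=
  fun w => if excluded_middle_informative (w = v) then 0 else a w / (1 - a v).

Lemma face_projection_realization simp simp' a v : in_realization simp a -> a v < 1 ->
  ((exists w, w <> v /\ a w <> 0) -> simp' (fun w => w <> v /\ a w <> 0)) ->
  in_realization simp' (face_projection v a) /\
  forall w, face_projection v a w <> 0 <-> w <> v /\ a w <> 0.
Proof.
  intros Ha Hv Hs. destruct (realization_split simp a v Ha) as (l & Hnd & Hin & Hsum).
  assert (Hsupp : forall w, face_projection v a w <> 0 <-> w <> v /\ a w <> 0).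
  { intros w. unfold face_projection. destruct (excluded_middle_informative (w = v)) as [->|h].
    - split; [intros h; exfalso; apply h; auto|tauto].
    - split.
      + intros h'. split; auto. intros h0. apply h'. rewrite h0. unfold Rdiv. ring.
      + intros [_ h']. unfold Rdiv. apply Rmult_integral_contrapositive_currified; auto.
        apply Rinv_neq_0_compat. lra. }
  split; auto. split; [|split].
  - intros w. unfold face_projection. destruct (excluded_middle_informative (w = v)); [lra|].
    apply Rmult_le_pos; [apply Ha|]. apply Rlt_le, Rinv_0_lt_compat. lra.
  - replace (support (face_projection v a)) with (fun w => w <> v /\ a w <> 0).
    + apply Hs. destruct l as [|w l]; [simpl in Hsum; lra|]. exists w. apply Hin. left; auto.
    + extensionality w. apply propositional_extensionality. unfold support. rewrite Hsupp. tauto.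
  - exists l. split; auto. split.
    + intros w. rewrite Hin, Hsupp. tauto.
    + assert (Hnv : forall w, In w l -> w <> v) by (intros w Hw; apply Hin, Hw).
      assert (E : coordinate_sum l (face_projection v a) = coordinate_sum l a / (1 - a v)).
      { clear Hnd Hin Hsum. induction l as [|w l IH]; simpl; [unfold Rdiv; ring|].
        rewrite IH by (intros; apply Hnv; right; auto). unfold face_projection at 1.
        destruct (excluded_middle_informative (w = v)) as [h|h].
        - exfalso. apply (Hnv w); simpl; auto.
        - field. lra. }
      rewrite E. replace (coordinate_sum l a) with (1 - a v) by lra. field. lra.
Qed.

(** For values at [v] of at most 1/2 both denominators have inverses at most 2, and the numerator of
    the difference is below [2 * r]; hence the factor 8. *)
Lemma face_projection_lipschitz simp a b v w r : in_realization simp a -> in_realization simp b ->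
  a v <= 1 / 2 -> b v <= 1 / 2 -> Rabs (a v - b v) < r -> Rabs (a w - b w) < r ->
  Rabs (face_projection v a w - face_projection v b w) < 8 * r.
Proof.
  intros Ha Hb Hav Hbv Hv Hw. unfold face_projection.
  pose proof (realization_bounds _ a v Ha). pose proof (realization_bounds _ b v Hb).
  pose proof (realization_bounds _ b w Hb).
  assert (Hr : 0 < r) by (pose proof (Rabs_pos (a v - b v)); lra).
  destruct (excluded_middle_informative (w = v)) as [->|h].
  - rewrite Rminus_diag, Rabs_R0. lra.
  - replace (a w / (1 - a v) - b w / (1 - b v)) with
      (((a w - b w) * (1 - b v) + b w * (a v - b v)) * (/ (1 - a v) * / (1 - b v))) by (field; lra).
    assert (Hi : forall t, 0 <= t <= 1 / 2 -> 0 < / (1 - t) <= 2).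
    { intros t Ht. split; [apply Rinv_0_lt_compat; lra|].
      replace 2 with (/ (1 / 2)) by field. apply Rinv_le_contravar; lra. }
    destruct (Hi (a v)) as [i1 i2]; [lra|]. destruct (Hi (b v)) as [j1 j2]; [lra|].
    rewrite Rabs_mult.
    assert (K : Rabs ((a w - b w) * (1 - b v) + b w * (a v - b v)) < 2 * r).
    { eapply Rle_lt_trans; [apply Rabs_triang|]. rewrite !Rabs_mult.
      rewrite (Rabs_right (1 - b v)) by lra. rewrite (Rabs_right (b w)) by lra.
      pose proof (Rabs_pos (a v - b v)). pose proof (Rabs_pos (a w - b w)). nra. }
    rewrite (Rabs_right (/ (1 - a v) * / (1 - b v))) by nra.
    pose proof (Rabs_pos ((a w - b w) * (1 - b v) + b w * (a v - b v))).
    assert (0 < / (1 - a v) * / (1 - b v) <= 4) by (split; nra). nra.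
Qed.

(* Maps are written on all of V -> R and only matter on the realization; continuity in the
   Whitehead topology is continuity on every closed simplex. *)
Definition simplexwise_continuous simp (g : (V -> R) -> Y) : Prop :=
  forall sigma, simp sigma -> forall a, in_realization simp a -> subset (support a) sigma ->
  forall e, 0 < e -> exists r, 0 < r /\ forall b, in_realization simp b ->
    subset (support b) sigma -> (forall v, sigma v -> Rabs (a v - b v) < r) -> rho (g a) (g b) < e.

Definition simplexwise_continuous_homotopy simp (H : (V -> R) -> R -> Y) : Prop :=
  forall sigma, simp sigma -> forall a t, in_realization simp a -> subset (support a) sigma ->
  0 <= t <= 1 -> forall e, 0 < e -> exists r, 0 < r /\ forall b s, in_realization simp b ->
    subset (support b) sigma -> (forall v, sigma v -> Rabs (a v - b v) < r) ->
    0 <= s <= 1 -> Rabs (s - t) < r -> rho (H a t) (H b s) < e.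

Lemma ball_open y e : metric_open rho (fun z => rho y z < e).
Proof.
  intros z Hz. exists (e - rho y z). split; [lra|]. intros w Hw.
  destruct metric as (_ & _ & _ & Htri). specialize (Htri y z w). lra.
Qed.

Lemma metric_refl y : rho y y = 0.
Proof. apply metric. auto. Qed.

(** Passes from the subtype [realization simp] to functions on all of [V -> R], the common domain
    for all subcomplexes of one nerve; off the realization [c] is a default value. *)
Lemma hook_omega_extension simp (S T : Y -> Prop) (g : (V -> R) -> Y) :
  hook_omega rho S T -> fd_simplicial_complex simp -> simplexwise_continuous simp g ->
  (forall a, in_realization simp a -> S (g a)) ->
  exists H c, T c /\ simplexwise_continuous_homotopy simp H /\
    forall a, in_realization simp a -> (forall t, 0 <= t <= 1 -> T (H a t)) /\
      H a 0 = g a /\ H a 1 = c.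
Proof.
  intros Hhook Hfd Hg HgS.
  destruct (Hhook V simp Hfd (fun p => g (proj1_sig p))) as (H & H1 & H2 & H3 & c & H4 & H5).
  - intros W HW sigma Hs a Ha Hsub. destruct (HW _ Ha) as (e & He & HeW).
    destruct (Hg sigma Hs (proj1_sig a) (proj2_sig a) Hsub e He) as (r & Hr & Hrb).
    exists r. split; auto. intros b Hb Hab. apply HeW, Hrb; auto. apply proj2_sig.
  - intros a. apply HgS, proj2_sig.
  - exists (fun a t => match excluded_middle_informative (in_realization simp a) with
      | left h => H (exist _ a h) t | right _ => c end), c.
    split; auto. split.
    + intros sigma Hs a t Ha Hsub Ht e He.
      destruct (excluded_middle_informative (in_realization simp a)) as [ha|]; [|tauto].
      destruct (H1 _ (ball_open (H (exist _ a ha) t) e) (exist _ a ha) t Ht)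
        as (U & r & HU & HUa & Hr & HUr); [rewrite metric_refl; auto|].
      destruct (HU sigma Hs (exist _ a ha) HUa Hsub) as (r' & Hr' & HUr').
      exists (Rmin r r'). split; [apply Rmin_glb_lt; auto|].
      intros b s Hb Hbs Hab Hs01 Hst.
      destruct (excluded_middle_informative (in_realization simp b)) as [hb|]; [|tauto].
      apply HUr; auto.
      * apply HUr'; auto. intros v Hv. simpl. eapply Rlt_le_trans; [apply Hab; auto|apply Rmin_r].
      * eapply Rlt_le_trans; [exact Hst|apply Rmin_l].
    + intros a Ha. destruct (excluded_middle_informative (in_realization simp a)) as [ha|]; [|tauto].
      split; [intros t Ht; apply H2; auto|]. split; [rewrite H3; auto|apply H5].
Qed.

(* The homotopy runs on [0,1/2] only and is constant on [1/2,1], so that continuity at the cone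
   point needs no compactness of the base. *)
Definition cone_map (v : V) (H : (V -> R) -> R -> Y) (c : Y) a : Y :=
  if Rlt_dec (a v) (1 / 2) then H (face_projection v a) (2 * a v) else c.

(** Since [H] ends at [c], the formula through [H] also holds at [a v = 1 / 2], and a point [b]
    beyond 1/2 is compared with time 1 over the projection of [a]. *)
Lemma cone_map_continuous simp simp' sigma v H c a :
  simp' (fun w => w <> v /\ sigma w) \/ (forall w, sigma w -> w = v) ->
  (forall b, in_realization simp b -> subset (support b) sigma ->
     (exists w, w <> v /\ b w <> 0) -> simp' (fun w => w <> v /\ b w <> 0)) ->
  sigma v ->
  simplexwise_continuous_homotopy simp' H -> (forall b, in_realization simp' b -> H b 1 = c) ->
  in_realization simp a -> subset (support a) sigma ->
  forall e, 0 < e -> exists r, 0 < r /\ forall b, in_realization simp b ->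
    subset (support b) sigma -> (forall v, sigma v -> Rabs (a v - b v) < r) ->
    rho (cone_map v H c a) (cone_map v H c b) < e.
Proof.
  intros Hsig Hface Hv HH Hc Ha Hasub e He.
  destruct (Rlt_dec (1 / 2) (a v)) as [hav|hav].
  - exists (a v - 1 / 2). split; [lra|]. intros b Hb Hbs Hab. unfold cone_map.
    specialize (Hab v Hv). apply Rabs_def2 in Hab.
    destruct (Rlt_dec (a v) (1 / 2)); [lra|]. destruct (Rlt_dec (b v) (1 / 2)); [lra|].
    rewrite metric_refl. auto.
  - assert (Hpr : forall b, in_realization simp b -> subset (support b) sigma -> b v <= 1 / 2 ->
      in_realization simp' (face_projection v b) /\
      forall w, face_projection v b w <> 0 <-> w <> v /\ b w <> 0).
    { intros b Hb Hbs Hbv. apply (face_projection_realization simp); auto. lra. }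
    assert (Hsub : forall b, in_realization simp b -> subset (support b) sigma -> b v <= 1 / 2 ->
      subset (support (face_projection v b)) (fun w => w <> v /\ sigma w)).
    { intros b Hb Hbs Hbv w Hw. apply (Hpr b) in Hw; auto. destruct Hw as [h1 h2].
      split; auto. }
    destruct Hsig as [Hsig|Hsig].
    (* If [v] is the only vertex of the simplex, a point with [a v <= 1 / 2] would project to a
       point of empty support. *)
    2:{ exfalso. destruct (Hpr a) as [(_ & _ & l & _ & Hl & Hl1) Hpa]; auto; [lra|].
        destruct l as [|w l]; [simpl in Hl1; lra|].
        assert (hw : face_projection v a w <> 0) by (apply Hl; left; auto).
        apply Hpa in hw. destruct hw as [h1 h2]. apply h1, Hsig, Hasub, h2. }
    pose proof (realization_bounds _ a v Ha) as Hb01.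
    assert (Ea : cone_map v H c a = H (face_projection v a) (2 * a v)).
    { unfold cone_map. destruct (Rlt_dec (a v) (1 / 2)) as [|hn]; auto.
      replace (2 * a v) with 1 by lra. symmetry. apply Hc, Hpr; auto. lra. }
    rewrite Ea.
    destruct (HH _ Hsig (face_projection v a) (2 * a v)) with (e := e) as (r & Hr & Hrb); auto.
    { apply Hpr; auto; lra. } { apply Hsub; auto; lra. } { lra. }
    (* The projection enlarges differences by a factor of at most 8, and time by 2. *)
    exists (r / 8). split; [lra|]. intros b Hb Hbs Hab.
    pose proof (realization_bounds _ b v Hb) as Hbb.
    pose proof (Hab v Hv) as Habv.
    destruct (Rle_dec (b v) (1 / 2)) as [hbv|hbv].
    + assert (Eb : cone_map v H c b = H (face_projection v b) (2 * b v)).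
      { unfold cone_map. destruct (Rlt_dec (b v) (1 / 2)) as [|hn]; auto.
        replace (2 * b v) with 1 by lra. symmetry. apply Hc, Hpr; auto. }
      rewrite Eb. apply Hrb; auto.
      * apply Hpr; auto.
      * intros w [Hw1 Hw]. replace r with (8 * (r / 8)) by field.
        apply (face_projection_lipschitz simp); auto; lra.
      * lra.
      * apply Rabs_def2 in Habv. apply Rabs_def1; lra.
    + unfold cone_map. destruct (Rlt_dec (b v) (1 / 2)); [lra|].
      rewrite <- (Hc (face_projection v a)) by (apply Hpr; auto; lra). apply Hrb.
      * apply Hpr; auto; lra.
      * apply Hsub; auto; lra.
      * intros w _. rewrite Rminus_diag, Rabs_R0. lra.
      * lra.
      * apply Rabs_def2 in Habv. apply Rabs_def1; lra.
Qed.

End Realization.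

(** * The map on the nerve, built level by level *)

Section Nerve.
Context {X I : Type} {K : nat} {V : nat -> I -> X -> Prop}.
Hypothesis Vdis : forall j i i' x, i <> i' -> V j i x -> V j i' x -> False.

(* The vertex (j, i) stands for the i-th member of the j-th disjoint family. *)
Definition in_star (x : X) (v : nat * I) : Prop := (fst v < K)%nat /\ V (fst v) (snd v) x.

(** For the whole space this is the subcomplex spanned by the levels from [n] on. With one member of
    level [n] as [A], and [S n] as the bound, it is the link of that vertex. *)
Definition nerve (A : X -> Prop) (n : nat) (sigma : nat * I -> Prop) : Prop :=
  (exists v, sigma v) /\ exists x, A x /\ forall v, sigma v -> (n <= fst v)%nat /\ in_star x v.

Lemma in_star_level x v w : in_star x v -> in_star x w -> fst v = fst w -> v = w.
Proof.
  intros [_ Hv] [_ Hw] E. destruct v as [j i], w as [j' i']; simpl in *. subst j'.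
  destruct (classic (i = i')) as [->|h]; auto. exfalso. eauto.
Qed.

Lemma in_star_finite x m : exists l, (length l <= m)%nat /\
  forall v, (fst v < m)%nat -> in_star x v -> In v l.
Proof.
  induction m as [|m (l & Hl & Hin)].
  - exists nil. split; auto. intros v Hv. lia.
  - destruct (classic (exists v, fst v = m /\ in_star x v)) as [(v & Hv & Hx)|h].
    + exists (v :: l). split; [simpl; lia|]. intros w Hw Hwx.
      destruct (Nat.eq_dec (fst w) m) as [e|e].
      * left. apply (in_star_level x); auto. congruence.
      * right. apply Hin; auto. lia.
    + exists l. split; [lia|]. intros w Hw Hwx. apply Hin; auto.
      assert (fst w <> m) by (intros e; apply h; eauto). lia.
Qed.

Lemma nerve_fd A n : fd_simplicial_complex (nerve A n).
Proof.
  assert (H : forall s, nerve A n s -> exists l, (length l <= K)%nat /\ forall v, s v -> In v l).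
  { intros s (_ & x & _ & Hx). destruct (in_star_finite x K) as (l & Hl & Hin).
    exists l. split; auto. intros v Hv. apply Hin; [|apply Hx, Hv]. apply Hx in Hv. apply Hv. }
  split; [|split].
  - intros s Hs. split; [|apply Hs]. destruct (H s Hs) as (l & _ & Hl). exists l. auto.
  - intros s t (_ & x & Hx & Hs) Hts Ht. split; auto. exists x. auto.
  - exists K. intros s Hs. destruct (H s Hs) as (l & Hl & Hin). exists l. auto.
Qed.

Lemma nerve_sub A B m n sigma : (forall x, A x -> B x) -> (n <= m)%nat ->
  nerve A m sigma -> nerve B n sigma.
Proof.
  intros HAB Hmn (H & x & Hx & Hs). split; auto. exists x. split; auto.
  intros v Hv. destruct (Hs v Hv). split; auto. lia.
Qed.

Lemma nerve_top A sigma : nerve A K sigma -> False.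
Proof. intros ((v & Hv) & x & _ & Hx). apply Hx in Hv. destruct Hv as [h [h' _]]. lia. Qed.

Lemma nerve_level_sub A n sigma t : nerve A n sigma -> (forall v, t v -> sigma v) ->
  (exists v, t v) -> (forall v, t v -> fst v <> n) -> nerve A (S n) t.
Proof.
  intros (_ & x & Hx & Hs) Hts Ht Hn. split; auto. exists x. split; auto.
  intros v Hv. destruct (Hs v (Hts v Hv)) as [h1 h2]. split; auto. specialize (Hn v Hv). lia.
Qed.

(** Vertices of equal level never share a simplex, so the face opposite to [v] has vertices of later
    levels only. *)
Lemma nerve_link A n sigma v t : nerve A n sigma -> sigma v -> fst v = n ->
  (exists w, t w) -> (forall w, t w -> sigma w /\ w <> v) -> nerve (fun x => in_star x v) (S n) t.
Proof.
  intros (_ & x & Hx & Hs) Hv Hn Ht Hts. split; auto. exists x. split; [apply Hs; auto|].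
  intros w Hw. destruct (Hts w Hw) as [h1 h2]. destruct (Hs w h1) as [h3 h4]. split; auto.
  assert (fst w <> n).
  { intros e. apply h2. apply (in_star_level x); [auto|apply Hs; auto|congruence]. }
  lia.
Qed.

Context {Y : Type} {rho : Y -> Y -> R}.
Hypothesis metric : is_metric rho.
Hypothesis Yinh : inhabited Y.
Context {Phi : nat -> X -> Y -> Prop} {S0 T0 : nat -> I -> Y -> Prop}.
Hypothesis PhiS : forall n i x y, V n i x -> Phi (S n) x y -> S0 n i y.
Hypothesis TPhi : forall n i x y, V n i x -> T0 n i y -> Phi n x y.
Hypothesis Phi_decr : forall n x y, Phi (S n) x y -> Phi n x y.
Hypothesis hook : forall n i, hook_omega rho (S0 n i) (T0 n i).

(** The invariant concerns every [x] whose star contains the support of [a]. A simplex in the link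
    of [(n, i)] has such an [x] in [V n i], so [g] maps the link into [S0 n i]; the cone stays in
    [T0 n i], hence in [Phi n x] for all [x] in [V n i]. *)
Lemma nerve_extension n : (n < K)%nat -> forall g : (nat * I -> R) -> Y,
  simplexwise_continuous (rho := rho) (nerve (fun _ => True) (S n)) g ->
  (forall a x, in_realization (nerve (fun _ => True) (S n)) a -> subset (support a) (in_star x) ->
    Phi (S n) x (g a)) ->
  exists g' : (nat * I -> R) -> Y,
  simplexwise_continuous (rho := rho) (nerve (fun _ => True) n) g' /\
  forall a x, in_realization (nerve (fun _ => True) n) a -> subset (support a) (in_star x) ->
    Phi n x (g' a).
Proof.
  intros HnK g Hg HgPhi.
  set (lk := fun i => nerve (fun x => in_star x (n, i)) (S n)).
  assert (Hlk : forall i s, lk i s -> nerve (fun _ => True) (S n) s)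
    by (intros i s; apply nerve_sub; auto).
  assert (Hlkr : forall i a, in_realization (lk i) a -> in_realization (nerve (fun _ => True) (S n)) a).
  { intros i a Ha. apply (realization_mono (lk i)); auto. apply (Hlk i), Ha. }
  assert (HH : forall i, exists q : ((nat * I -> R) -> R -> Y) * Y,
    T0 n i (snd q) /\ simplexwise_continuous_homotopy (rho := rho) (lk i) (fst q) /\
    forall a, in_realization (lk i) a -> (forall t, 0 <= t <= 1 -> T0 n i (fst q a t)) /\
      fst q a 0 = g a /\ fst q a 1 = snd q).
  { intros i. destruct (hook_omega_extension metric (lk i) (S0 n i) (T0 n i) g) as (H & c & h).
    - apply hook.
    - apply nerve_fd.
    - intros s Hs a Ha Hsub e He.
      destruct (Hg s (Hlk i s Hs) a (Hlkr i a Ha) Hsub e He) as (r & Hr & Hrb).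
      exists r. split; auto. intros b Hb. apply Hrb. apply (Hlkr i b Hb).
    - intros a Ha. pose proof Ha as (_ & (_ & x & Hx & Hs) & _).
      apply (PhiS n i x); [apply Hx|]. apply HgPhi; [apply (Hlkr i a Ha)|].
      intros v Hv. apply Hs, Hv.
    - exists (H, c). exact h. }
  apply choice in HH. destruct HH as [q Hq].
  set (C := fun i => cone_map (n, i) (fst (q i)) (snd (q i))).
  assert (Hg' : forall a, exists y, (forall i, a (n, i) <> 0 ->
      in_realization (nerve (fun _ => True) n) a -> y = C i a) /\
    ((forall i, a (n, i) = 0) -> y = g a)).
  { intros a. destruct (classic (exists i, a (n, i) <> 0)) as [[i Hi]|h].
    - exists (C i a). split.
      + intros i' Hi' (_ & (_ & x & _ & Hs) & _).
        assert (E : (n, i) = (n, i')) by (apply (in_star_level x); auto; apply Hs; auto).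
        injection E as ->. auto.
      + intros h. exfalso. auto.
    - exists (g a). split; auto. intros i Hi. exfalso. eauto. }
  apply choice in Hg'. destruct Hg' as [g' Hg'].
  (* On a closed simplex with vertex [(n, i)] the cone formula also holds on the opposite face,
     where it is [g] at time 0. Continuity on this simplex thus becomes continuity of a single cone
     map. *)
  assert (HC0 : forall i s a, nerve (fun _ => True) n s -> s (n, i) ->
    in_realization (nerve (fun _ => True) n) a -> subset (support a) s -> g' a = C i a).
  { intros i s a Hs Hi Ha Hsub. destruct (Req_dec (a (n, i)) 0) as [h|h]; [|apply Hg'; auto].
    assert (Hall : forall i', a (n, i') = 0).
    { intros i'. apply NNPP. intros h'. destruct Hs as (_ & x & _ & Hs).
      assert (E : (n, i') = (n, i)).
      { apply (in_star_level x); auto; [apply Hs, Hsub, h'|apply Hs, Hi]. }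
      congruence. }
    rewrite (proj2 (Hg' a) Hall). unfold C, cone_map. rewrite h.
    destruct (Rlt_dec 0 (1 / 2)); [|lra].
    assert (Hfp : face_projection (n, i) a = a).
    { extensionality w. unfold face_projection.
      destruct (excluded_middle_informative (w = (n, i))) as [->|]; [auto|].
      rewrite h. field. }
    rewrite Hfp. replace (2 * 0) with 0 by ring. symmetry. apply (Hq i).
    apply (realization_mono (nerve (fun _ => True) n)); auto.
    unfold lk. apply (nerve_link (fun _ => True) n s); auto; [apply Ha|].
    intros w Hw. split; [apply Hsub, Hw|]. intros ->. apply Hw, h. }
  exists g'. split.
  - intros s Hs a Ha Hsub e He.
    destruct (classic (exists i, s (n, i))) as [[i Hi]|h].
    + destruct (cone_map_continuous metric (nerve (fun _ => True) n) (lk i) s (n, i)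
        (fst (q i)) (snd (q i)) a) with (e := e) as (r & Hr & Hrb); auto.
      * destruct (classic (exists w, w <> (n, i) /\ s w)) as [h|h]; [left|right].
        -- apply (nerve_link (fun _ => True) n s); auto. tauto.
        -- intros w Hw. apply NNPP. intros h'. apply h. eauto.
      * intros b Hb Hbs Hex. apply (nerve_link (fun _ => True) n s); auto.
        intros w [h1 h2]. split; auto.
      * apply Hq.
      * intros b Hb. apply (Hq i), Hb.
      * exists r. split; auto. intros b Hb Hbs Hab.
        rewrite (HC0 i s a), (HC0 i s b); auto. apply Hrb; auto.
    + assert (Hno : forall b, subset (support b) s -> forall i, b (n, i) = 0).
      { intros b Hbs i. apply NNPP. intros h'. apply h. exists i. apply Hbs, h'. }
      assert (Hs' : nerve (fun _ => True) (S n) s).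
      { apply (nerve_level_sub _ n s); auto; [apply Hs|]. intros [j i] Hv; simpl.
        intros ->. eauto. }
      assert (Hr : forall b, in_realization (nerve (fun _ => True) n) b -> subset (support b) s ->
        in_realization (nerve (fun _ => True) (S n)) b).
      { intros b Hb Hbs. apply (realization_mono (nerve (fun _ => True) n)); auto.
        apply (nerve_fd (fun _ => True) (S n)) with (s := s); auto. apply Hb. }
      destruct (Hg s Hs' a (Hr a Ha Hsub) Hsub e He) as (r & Hr0 & Hrb).
      exists r. split; auto. intros b Hb Hbs Hab.
      rewrite (proj2 (Hg' a)), (proj2 (Hg' b)); auto.
  - intros a x Ha Hx. destruct (classic (exists i, a (n, i) <> 0)) as [[i Hi]|h].
    + rewrite (proj1 (Hg' a) i Hi Ha). unfold C, cone_map.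
      apply (TPhi n i x); [apply (Hx (n, i)); auto|].
      pose proof (realization_bounds _ a (n, i) Ha).
      destruct (Rlt_dec (a (n, i)) (1 / 2)); [|apply Hq].
      apply (Hq i); [|lra].
      apply (face_projection_realization (nerve (fun _ => True) n)); auto; [lra|].
      intros Hex. apply (nerve_link (fun _ => True) n (support a)); auto.
      * apply Ha.
      * unfold support. tauto.
    + assert (Hno : forall i, a (n, i) = 0).
      { intros i. apply NNPP. intros h'. eauto. }
      rewrite (proj2 (Hg' a) Hno). apply Phi_decr. apply HgPhi; auto.
      apply (realization_mono (nerve (fun _ => True) n)); auto.
      apply (nerve_level_sub _ n (support a)); auto; [apply Ha|apply Ha|].
      intros [j i] Hv; simpl. intros ->. apply Hv, Hno.
Qed.

Lemma nerve_map : exists g : (nat * I -> R) -> Y,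
  simplexwise_continuous (rho := rho) (nerve (fun _ => True) 0) g /\
  forall a x, in_realization (nerve (fun _ => True) 0) a -> subset (support a) (in_star x) ->
    Phi 0%nat x (g a).
Proof.
  assert (H : forall m, (m <= K)%nat -> exists g : (nat * I -> R) -> Y,
    simplexwise_continuous (rho := rho) (nerve (fun _ => True) (K - m)) g /\
    forall a x, in_realization (nerve (fun _ => True) (K - m)) a ->
      subset (support a) (in_star x) -> Phi (K - m)%nat x (g a)).
  { induction m as [|m IH]; intros Hm.
    (* No vertex has level [K] or more, so the complex is empty and any constant map starts the
       descent. *)
    - rewrite Nat.sub_0_r. destruct Yinh as [y]. exists (fun _ => y). split.
      + intros s Hs. exfalso. eapply nerve_top; eauto.
      + intros a x Ha. exfalso. eapply nerve_top. apply Ha.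
    - destruct IH as (g & h1 & h2); [lia|].
      replace (K - m)%nat with (S (K - S m)) in h1, h2 by lia.
      apply (nerve_extension (K - S m)) with (g := g); auto. lia. }
  specialize (H K (le_n K)). rewrite Nat.sub_diag in H. exact H.
Qed.

End Nerve.

(** * The barycentric map into the nerve *)

Section ContinuousAt.
Context {X : Type} {op : (X -> Prop) -> Prop}.
Hypothesis top : is_topology op.

Definition continuous_at (f : X -> R) (x : X) : Prop :=
  forall e, 0 < e -> exists N, op N /\ N x /\ forall y, N y -> Rabs (f y - f x) < e.

Lemma real_continuous_at f x : real_continuous (op := op) f -> continuous_at f x.
Proof.
  intros H e He. exists (fun y => f x - e < f y /\ f y < f x + e). split; [|split].
  - apply (open_and top); apply H.
  - lra.
  - intros y Hy. apply Rabs_def1; lra.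
Qed.

Lemma continuous_at_comp h f x : continuity_pt h (f x) -> continuous_at f x ->
  continuous_at (fun y => h (f y)) x.
Proof.
  intros Hh Hf e He. destruct (Hh e He) as (d & Hd & Hdh). destruct (Hf d Hd) as (N & HN & HNx & H).
  exists N. repeat split; auto. intros y Hy.
  destruct (Req_dec (f y) (f x)) as [->|hne].
  - rewrite Rminus_diag, Rabs_R0. auto.
  - apply Hdh. split; [split; [exact I|auto]|]. apply H, Hy.
Qed.

Lemma continuous_at_plus f g x : continuous_at f x -> continuous_at g x ->
  continuous_at (fun y => f y + g y) x.
Proof.
  intros Hf Hg e He. destruct (Hf (e / 2)) as (N & HN & HNx & H); [lra|].
  destruct (Hg (e / 2)) as (M & HM & HMx & H'); [lra|].
  exists (fun y => N y /\ M y). split; [apply (open_and top); auto|]. split; auto.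
  intros y [h1 h2]. specialize (H y h1). specialize (H' y h2).
  apply Rabs_def2 in H. apply Rabs_def2 in H'. apply Rabs_def1; lra.
Qed.

Lemma continuous_at_ext f g x : (forall y, f y = g y) -> continuous_at f x -> continuous_at g x.
Proof.
  intros H Hf e He. destruct (Hf e He) as (N & HN & HNx & h). exists N. repeat split; auto.
  intros y Hy. rewrite <- !H. auto.
Qed.

(** Polarisation turns the product into squares of sums, that is, into compositions with functions
    of one variable. *)
Lemma continuous_at_mult f g x : continuous_at f x -> continuous_at g x ->
  continuous_at (fun y => f y * g y) x.
Proof.
  intros Hf Hg.
  assert (Hn : continuous_at (fun y => - g y) x) by (apply (continuous_at_comp Ropp); auto; reg).
  apply (continuous_at_ext (fun y => (f y + g y) * (f y + g y) / 4 + - ((f y + - g y) * (f y + - g y) / 4)));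
    [intros; field|].
  apply continuous_at_plus.
  - apply (continuous_at_comp (fun t => t * t / 4) (fun y => f y + g y)); [reg|].
    apply continuous_at_plus; auto.
  - apply (continuous_at_comp (fun t => - (t * t / 4)) (fun y => f y + - g y)); [reg|].
    apply continuous_at_plus; auto.
Qed.

Lemma continuous_at_sum {J : Type} (l : list J) (f : J -> X -> R) x :
  (forall j, continuous_at (f j) x) -> continuous_at (fun y => coordinate_sum l (fun j => f j y)) x.
Proof.
  intros H. induction l as [|j l IH]; simpl.
  - intros e He. exists (fun _ => True). split; [apply (open_true top)|]. split; auto.
    intros y _. rewrite Rminus_diag, Rabs_R0. auto.
  - apply continuous_at_plus; auto.
Qed.

End ContinuousAt.

Section BarycentricMap.
Context {X I : Type} {op : (X -> Prop) -> Prop} {K : nat} {V : nat -> I -> X -> Prop}.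
Hypothesis top : is_topology op.
Hypothesis Vopen : forall j i, op (V j i).
Hypothesis Vdis : forall j i i' x, i <> i' -> V j i x -> V j i' x -> False.
Notation star := (in_star (K := K) (V := V)).
Notation N0 := (nerve (K := K) (V := V) (fun _ => True) 0).

(** Weights are given per level: a point lies in at most one member of each family, and that member
    receives the weight. *)
Definition barycentric (mu : nat -> R) (x : X) : nat * I -> R :=
  fun v => if excluded_middle_informative (star x v)
           then mu (fst v) / coordinate_sum (seq 0 K) mu else 0.

Lemma star_enumeration x (mu : nat -> R) m : (m <= K)%nat -> (forall j, 0 <= mu j) ->
  (forall j, 0 < mu j -> exists i, star x (j, i)) ->
  exists l, NoDup l /\ (forall v, In v l <-> (fst v < m)%nat /\ star x v /\ 0 < mu (fst v)) /\
    coordinate_sum l (fun v => mu (fst v)) = coordinate_sum (seq 0 m) mu.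
Proof.
  intros Hm Hmu Hex. induction m as [|m IH].
  - exists nil. split; [constructor|]. split; [|auto]. intros v. simpl. split; [tauto|lia].
  - destruct IH as (l & Hnd & Hin & Hs); [lia|].
    rewrite seq_S, coordinate_sum_app, <- Hs. simpl.
    destruct (Rlt_dec 0 (mu m)) as [h|h].
    + destruct (Hex m h) as [i Hi]. exists ((m, i) :: l). split; [|split].
      * constructor; auto. intros h'. apply Hin in h'. simpl in h'. lia.
      * intros v. simpl. rewrite Hin. split.
        -- intros [<-|(h1 & h2)]; simpl; [repeat split; auto; apply Hi|]. split; auto.
        -- intros (h1 & h2 & h3). destruct (Nat.eq_dec (fst v) m) as [e|e].
           ++ left. apply (in_star_level (K := K) Vdis x); auto.
           ++ right. split; auto. lia.
      * simpl. lra.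
    + exists l. split; auto. split.
      * intros v. rewrite Hin. split; intros (h1 & h2 & h3); split; auto.
        assert (fst v <> m) by (intros e; rewrite e in h3; auto). lia.
      * specialize (Hmu m). lra.
Qed.

Lemma barycentric_realization x (mu : nat -> R) : (forall j, 0 <= mu j) ->
  (forall j, 0 < mu j -> exists i, star x (j, i)) -> 0 < coordinate_sum (seq 0 K) mu ->
  in_realization N0 (barycentric mu x) /\ forall v, barycentric mu x v <> 0 -> star x v /\ 0 < mu (fst v).
Proof.
  intros Hmu Hex Hpos. destruct (star_enumeration x mu K) as (l & Hnd & Hin & Hs); auto.
  set (s := coordinate_sum (seq 0 K) mu) in *.
  assert (Hinv : 0 < / s) by (apply Rinv_0_lt_compat; auto).
  assert (Hnz : forall v, barycentric mu x v <> 0 <-> In v l).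
  { intros v. rewrite Hin. unfold barycentric. fold s.
    destruct (excluded_middle_informative (star x v)) as [h|h].
    - split.
      + intros h'. split; [apply h|]. split; auto. destruct (Hmu (fst v)) as [h0|h0]; auto.
        exfalso. apply h'. rewrite <- h0. unfold Rdiv. ring.
      + intros (_ & _ & h0). unfold Rdiv. nra.
    - split; [intros h'; exfalso; apply h'; auto|tauto]. }
  split; [|intros v Hv; apply Hnz, Hin in Hv; tauto].
  split; [|split].
  - intros v. unfold barycentric. fold s. destruct (excluded_middle_informative (star x v)); [|lra].
    apply Rmult_le_pos; auto. lra.
  - split.
    + destruct l as [|v l]; [simpl in Hs; lra|]. exists v. apply Hnz. left; auto.
    + exists x. split; auto. intros v Hv. apply Hnz, Hin in Hv. split; [lia|tauto].
  - exists l. split; auto. split; [intros v; symmetry; apply Hnz|].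
    assert (E : coordinate_sum l (barycentric mu x) = coordinate_sum l (fun v => mu (fst v)) / s).
    { assert (Hst : forall v, In v l -> star x v) by (intros v Hv; apply Hin, Hv).
      clear Hs Hin Hnz Hnd. induction l as [|v l IH]; simpl; [unfold Rdiv; ring|].
      rewrite IH by (intros; apply Hst; right; auto). unfold barycentric at 1. fold s.
      destruct (excluded_middle_informative (star x v)) as [h|h].
      - field. lra.
      - exfalso. apply h, Hst. left; auto. }
    rewrite E, Hs. field. lra.
Qed.

(* The cut-off at 1/2 makes the supports of the coordinates closed in the union of each family, so
   that near a point x only the vertices of its own carrier simplex matter. *)
Lemma nerve_map_composition {Y : Type} {rho : Y -> Y -> R} (f : nat -> X -> R)
  (g : (nat * I -> R) -> Y) :
  (forall j, real_continuous (op := op) (f j)) -> 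
  (forall j x, 0 < f j x -> exists i, star x (j, i)) ->
  (forall x, exists j, f j x = 1) ->
  simplexwise_continuous (rho := rho) N0 g ->
  exists b : X -> nat * I -> R, continuous_into op rho (fun x => g (b x)) /\
    forall x, in_realization N0 (b x) /\ subset (support (b x)) (star x).
Proof.
  intros Hf Hfs Hf1 Hg.
  set (mu := fun x j => Rmax 0 (f j x - 1 / 2)).
  assert (Hmu0 : forall x j, 0 <= mu x j) by (intros; apply Rmax_l).
  assert (Hmupos : forall x j, 0 < mu x j -> 1 / 2 < f j x).
  { intros x j h. unfold mu, Rmax in h. destruct (Rle_dec 0 (f j x - 1 / 2)); lra. }
  assert (Hmus : forall x j, 0 < mu x j -> exists i, star x (j, i)).
  { intros x j h. apply Hfs. apply Hmupos in h. lra. }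
  assert (Hsum : forall x, 0 < coordinate_sum (seq 0 K) (mu x)).
  { intros x. destruct (Hf1 x) as [j Hj].
    assert (Hjpos : 0 < mu x j) by (unfold mu, Rmax; destruct (Rle_dec 0 (f j x - 1 / 2)); lra).
    destruct (Hmus x j Hjpos) as (i & HjK & _). simpl in HjK.
    destruct (in_split j (seq 0 K)) as (l1 & l2 & E); [apply in_seq; lia|].
    rewrite E, coordinate_sum_app. simpl.
    pose proof (coordinate_sum_nonneg (mu x) l1 (Hmu0 x)).
    pose proof (coordinate_sum_nonneg (mu x) l2 (Hmu0 x)). lra. }
  assert (Hb : forall x, in_realization N0 (barycentric (mu x) x) /\
    forall v, barycentric (mu x) x v <> 0 -> star x v /\ 0 < mu x (fst v)).
  { intros x. apply barycentric_realization; auto. }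
  exists (fun x => barycentric (mu x) x). split; [|intros x; split; [apply Hb|intros v Hv; apply Hb, Hv]].
  assert (Hmuc : forall j x, continuous_at (op := op) (fun y => mu y j) x).
  { intros j x.
    apply (continuous_at_ext (fun y => (fun t => (t - 1 / 2 + Rabs (t - 1 / 2)) / 2) (f j y))).
    - intros y. unfold mu, Rmax. destruct (Rle_dec 0 (f j y - 1 / 2)).
      + rewrite Rabs_right by lra. field.
      + rewrite Rabs_left by lra. field.
    - apply (continuous_at_comp (fun t => (t - 1 / 2 + Rabs (t - 1 / 2)) / 2)).
      + reg.
      + apply (real_continuous_at top). auto. }
  assert (Hlc : forall j x, continuous_at (op := op)
    (fun y => mu y j / coordinate_sum (seq 0 K) (mu y)) x).
  { intros j x. apply (continuous_at_mult top); auto.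
    apply (continuous_at_comp Rinv).
    - apply (continuity_pt_inv id).
      + apply derivable_continuous_pt, derivable_pt_id.
      + unfold id. specialize (Hsum x). lra.
    - apply (continuous_at_sum top (seq 0 K) (fun j y => mu y j)). auto. }
  intros W HW. apply (open_local top). intros x Hx.
  destruct (HW _ Hx) as (e & He & HeW).
  (* The members containing [x] span one simplex. Near [x] the barycentric map stays in it, so
     continuity of [g] on this simplex is enough. *)
  assert (Hs : N0 (star x)).
  { destruct (Hb x) as ((_ & ((v & Hv) & _) & _) & h). split.
    - exists v. apply h, Hv.
    - exists x. split; auto. intros w Hw. split; [lia|auto]. }
  destruct (Hg (star x) Hs (barycentric (mu x) x) (proj1 (Hb x))) with (e := e) as (r & Hr & Hrb); auto.
  { intros v Hv. apply (Hb x), Hv. }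
  assert (HN : forall j, exists N, op N /\ N x /\ forall y, N y ->
    (forall i, star y (j, i) -> 0 < mu y j -> star x (j, i)) /\
    (forall i, star x (j, i) -> star y (j, i) /\
      Rabs (mu x j / coordinate_sum (seq 0 K) (mu x) - mu y j / coordinate_sum (seq 0 K) (mu y)) < r)).
  (* In a level with a member around [x], the neighbourhood stays in that member. In a level without
     one, [f j x] is not positive, so [f j] stays below 1/2 nearby and the level has no weight
     there. *)
  { intros j. destruct (classic (exists i, star x (j, i))) as [[i Hi]|h].
    - destruct (Hlc j x r Hr) as (N & HN & HNx & HNr).
      exists (fun y => N y /\ V j i y). split; [apply (open_and top); auto|].
      split; [split; [auto|apply Hi]|]. intros y [Hy1 Hy2].
      assert (Hyi : star y (j, i)) by (split; [apply Hi|exact Hy2]).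
      split.
      + intros i' Hi' _. replace i' with i; auto.
        assert (E : (j, i) = (j, i')) by (apply (in_star_level (K := K) Vdis y); auto). congruence.
      + intros i' Hi'. split.
        * replace i' with i; auto.
          assert (E : (j, i) = (j, i')) by (apply (in_star_level (K := K) Vdis x); auto). congruence.
        * rewrite Rabs_minus_sym. auto.
    - exists (fun y => f j y < 1 / 2). split; [apply Hf|]. split.
      + destruct (Rlt_dec 0 (f j x)) as [h0|h0]; [|lra]. exfalso. auto.
      + intros y Hy. split.
        * intros i _ h0. apply Hmupos in h0. lra.
        * intros i Hi. exfalso. eauto. }
  apply choice in HN. destruct HN as [N HN].
  exists (fun y => forall j, (j < K)%nat -> N j y). split; [|split].
  - apply (open_forall_lt top). intros j _. apply HN.
  - intros j _. apply HN.
  - intros y Hy. apply HeW, Hrb.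
    + apply Hb.
    + intros v Hv. apply (Hb y) in Hv. destruct Hv as [h1 h2]. destruct v as [j i].
      destruct (HN j) as (_ & _ & h). apply (h y); auto. apply Hy, h1.
    + intros [j i] Hv. destruct (HN j) as (_ & _ & h). destruct (h y) as [_ h']; [apply Hy, Hv|].
      destruct (h' i Hv) as [h1 h2]. unfold barycentric. simpl.
      destruct (excluded_middle_informative (star x (j, i))); [|tauto].
      destruct (excluded_middle_informative (star y (j, i))); [|tauto]. exact h2.
Qed.

End BarycentricMap.

Theorem theorem5p2 (X Y : Type) (op : (X -> Prop) -> Prop) (rho : Y -> Y -> R)
  (phi : X -> Y -> Prop) :
  is_topology op -> paracompact op -> finite_C_space op ->
  is_metric rho ->
  (forall x, exists y, phi x y) ->
  rho_continuous op rho phi ->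
  (forall x, uniformly_UV_omega rho (phi x)) ->
  forall eps : X -> R,
    (forall x, 0 < eps x) -> continuous_into op Rmetric eps ->
    exists f : X -> Y, continuous_into op rho f /\
      forall x, Onbhd rho (eps x) (phi x) (f x).
Proof.
  intros top para finC metric Hne Hphi HUV eps Heps Hcont.
  (* A point of [X] yields a point of [Y], from which the nerve map starts; for empty [X] the space
     [Y] may be empty too. *)
  destruct (classic (inhabited X)) as [[x0]|HX].
  2:{ exists (fun x => match HX (inhabits x) with end). split.
      - intros W HW. apply (open_local top). intros x. destruct (HX (inhabits x)).
      - intros x. destruct (HX (inhabits x)). }
  destruct (contracting_covers top para metric Hphi HUV (fun x => Onbhd rho (eps x) (phi x)))
    as (Phi & W & S & T & E0 & HPhi).
  { apply Onbhd_ample; auto. }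
  destruct (finite_C_arbitrary_covers top para finC W) as (K & V & Vop & VW & Vdis & Vcov);
    [apply HPhi|intros j x; apply HPhi|].
  (* One function per level, subordinate to the union of its family; from [K] on these unions are
     empty. *)
  destruct (function_cover top (proj1 finC) para (fun j x => exists i, in_star (K := K) (V := V) x (j, i)))
    as (f & f1 & f2 & f3 & f4 & _).
  { intros j. apply (open_exists top). intros i. apply (open_and top); [apply (open_const top)|apply Vop]. }
  { intros x. destruct (Vcov x I) as (j & i & Hj & Hx). exists j, i. split; simpl; [lia|auto]. }
  destruct (Hne x0) as [y0 _].
  destruct (nerve_map (K := K) (V := V) Vdis metric (inhabits y0) (Phi := Phi) (S0 := S) (T0 := T)) as (g & g1 & g2).
  - intros n i x y Hx. apply (proj1 (proj2 (proj2 (HPhi n)))). auto.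
  - intros n i x y Hx. apply (proj1 (proj2 (proj2 (proj2 (HPhi n))))). auto.
  (* For any [z] with [W n z x], the set [Phi (1 + n) x] lies in [S n z], this in [T n z], and this
     in [Phi n x]. *)
  - intros n x y Hy. destruct (HPhi n) as (_ & c2 & c3 & c4 & c5 & _). destruct (c2 x) as [z Hz].
    apply (c4 z); auto. apply c5. apply (c3 z x); auto.
  - intros n i. apply HPhi.
  - destruct (nerve_map_composition (rho := rho) top Vop Vdis f g f1 f3 f4 g1) as (b & b1 & b2).
    exists (fun x => g (b x)). split; auto. intros x.
    assert (H : Phi 0%nat x (g (b x))) by (apply g2; apply b2).
    rewrite E0 in H. exact H.
Qed.
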